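(* Let $\alpha\in(0,1)$ be such that $\alpha=\frac{\log t_0}{\log n_0}$ for some $t_0,n_0\in\mathbb{N}$, $n_0\neq 1$, and let $1\le p<\frac{4}{\alpha}-2$. Then there are a probability measure $\mu$ on $[0,1]$ supported on a set $E\subset[0,1]$ of Hausdorff dimension $\alpha$, and a sequence of functions $\{f_\ell\}_{\ell\in\mathbb{N}}$ on $[0,1]$, each of which is the characteristic function of a finite union of intervals, such that: (i) there is a constant $C_1$ such that $\mu(B(x,r))\le C_1 r^{\alpha}$ for all $x\in\mathbb{R}$ and $r>0$; (ii) for every $0<\beta<\alpha$ there is a constant $C_2=C_2(\beta)$ such that $|\widehat{\mu}(\xi)|\le C_2(1+|\xi|)^{-\beta/2}$ for all $\xi\in\mathbb{R}$; (iii) $$\frac{\|\widehat{f_\ell\,d\mu}\|_{L^p(\mathbb{R})}}{\|f_\ell\|_{L^2(d\mu)}}\to\infty\quad\text{as }\ell\to\infty.$$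
   Context: $B(x,r)$ is the ball (interval) in $\mathbb{R}$ with centre $x$ and radius $r$. Fourier transforms are $\widehat{\mu}(\xi)=\int e^{-2\pi i x\xi}\,d\mu(x)$ and $\widehat{f\,d\mu}(\xi)=\int f(x)e^{-2\pi i x\xi}\,d\mu(x)$. The $L^p(\mathbb{R})$ norm is with respect to Lebesgue measure and may take the value $+\infty$; the quotients in (iii) are understood to have nonzero denominators. *)

(* Defs.v *)
From mathcomp Require Import all_boot all_order all_algebra.
From mathcomp Require Import all_classical all_reals all_analysis.
From mathcomp Require Import complex.

Set Implicit Arguments.
Unset Strict Implicit.
Unset Printing Implicit Defensive.

Import Order.TTheory GRing.Theory Num.Theory.
Import numFieldNormedType.Exports.

Local Open Scope classical_set_scope.
Local Open Scope ring_scope.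
Local Open Scope complex_scope.

Definition diameter (R : realType) (A : set R) : \bar R :=
  ereal_sup [set `|x - y|%:E | x in A & y in A].

(* (diam U)^s, with the value 0 for the empty set also when s = 0 (where poweR
   gives 1), so that covers can be padded with empty sets. *)
Definition diameter_pow (R : realType) (s : R) (U : set R) : \bar R :=
  if U == set0 then 0%E else poweR (diameter U) s.

Definition hausdorff_premeasure (R : realType) (s delta : R) (A : set R)
    : \bar R :=
  ereal_inf [set (\sum_(0 <= i <oo) diameter_pow s (U i))%E
    | U in [set U : nat -> set R |
        A `<=` \bigcup_i U i /\ forall i, (diameter (U i) <= delta%:E)%E]].

(* The limit as delta -> 0+, a supremum since the premeasure increases as delta
   decreases; the usual normalizing constant is omitted. *)
Definition hausdorff_measure (R : realType) (s : R) (A : set R) : \bar R :=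
  ereal_sup [set hausdorff_premeasure s delta A
    | delta in [set delta : R | 0 < delta]].

Definition hausdorff_dim (R : realType) (A : set R) : \bar R :=
  ereal_inf [set s%:E
    | s in [set s : R | 0 <= s /\ hausdorff_measure s A = 0%E]].

Definition measure_support (R : realType)
    (mu : {measure set (measurableTypeR R) -> \bar R}) : set R :=
  [set x | forall r : R, 0 < r -> (0 < mu (ball x r))%E].

(* Intervals of every kind are allowed, degenerate ones included. *)
Definition finite_union_of_intervals (R : realType) (A : set R) : Prop :=
  exists s : seq (interval R), A = \big[setU/set0]_(i <- s) [set` i].

Definition expi (R : realType) (t : R) : R[i] := cos t +i* sin t.

Definition complex_integral (R : realType)
    (mu : {measure set (measurableTypeR R) -> \bar R}) (g : R -> R[i]) : R[i] :=
  (\int[mu]_x complex.Re (g x)) +i* (\int[mu]_x complex.Im (g x)).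

Definition fourier (R : realType)
    (mu : {measure set (measurableTypeR R) -> \bar R}) (xi : R) : R[i] :=
  complex_integral mu (fun x => expi (- (2 * pi * x * xi))).

Definition fourier_density (R : realType)
    (mu : {measure set (measurableTypeR R) -> \bar R}) (f : R -> R) (xi : R)
    : R[i] :=
  complex_integral mu (fun x => (f x)%:C * expi (- (2 * pi * x * xi))).

Notation normc := ComplexField.Normc.normc.

(* Main.v *)
(** Write n = n0, t = t0, so that t = n^alpha. A Cantor set in which every
    n-adic interval keeps t of its n children carries a measure nu with
    nu(B(x,r)) <= C r^alpha. If the kept children are chosen at random (a cyclic
    block of t consecutive children with a random offset), square-root
    cancellation makes nu a Salem measure; the random choice is derandomized by
    the method of conditional expectations.

    The measure mu is a convex combination over l of the following pieces:
    J = t^(Bl) copies of nu scaled by d = n^(-2Bl), hence J d^alpha = d^(alpha/2),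
    placed along the arithmetic progression of step b = 2^(-l) / J. Since
    J d^alpha = d^(alpha/2), the piece still has Fourier decay alpha/2, and as it
    lies in [0, 2^(-l)] the pieces accumulate only at 0. The function f_l is the
    indicator of the J intervals of length d supporting the l-th piece. Its
    transform is at least half of its mass on the part of {xi : |xi| <= c / d} lying
    within c / (J b) of the lattice b^(-1) Z, a set of measure about 1 / (d J); this
    makes the ratio grow like a positive power of 1 / d (up to 2^(-l)) exactly when
    p < 4 / alpha - 2. *)

Require Import Defs.
From HB Require Import structures.
From mathcomp Require Import all_boot all_order all_algebra.
From mathcomp Require Import all_classical all_reals all_analysis.
From mathcomp Require Import complex measurable_realfun ring lra zify.
Import Order.TTheory GRing.Theory Num.Theory.
Import numFieldNormedType.Exports.
Local Open Scope classical_set_scope.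
Local Open Scope ring_scope.
Set Implicit Arguments.
Unset Strict Implicit.
Unset Printing Implicit Defensive.

(** * Derandomized concentration *)

(** The Frostman bound lets a copy of scale d weigh at most about d^alpha. Condition (ii) is
    obtained with no cancellation between the copies of a progression: dilating nu by d costs a
    factor d^(-beta/2), which the mass J d^alpha of the piece has to absorb. This forces J <=
    d^(-alpha/2), and the largest such J is taken. Up to powers of 2^l, the piece then has mass m =
    d^(alpha/2), its transform is of size m on a set of measure d^(alpha/2 - 1), and the quotient in
    (iii) is at least of order m^(1/2) d^((alpha/2 - 1)/p); its exponent alpha/4 - (1 - alpha/2)/p
    is negative for p < 4/alpha - 2. The factors 2^(-l) make the bounds summable over l; B makes d
    so small that the gain outweighs them.

    Derandomization costs a logarithm of the number of frequencies tested. At level N this number is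
    exponential in N, so the loss is a factor N + 1, absorbed by passing from alpha to beta < alpha.

    Fourier decay is carried as an upper bound for integrals of 1 + cos (eta x + theta), for every
    theta: nonnegative integrands pass directly through image measures and infinite sums of
    measures. *)

Lemma expR_le_quadratic (R : realType) (x : R) :
  `|x| <= 1 / 2 -> expR x <= 1 + x + 2 * x ^+ 2.
Proof.
rewrite ler_norml => /andP[x1 x2].
have h1 : 1 - x <= expR (- x) by have := expR_ge1Dx (- x).
have h2 : expR x * expR (- x) = 1 by rewrite -expRD subrr expR0.
have h3 : 0 < expR x := expR_gt0 x.
have h4 : expR x * (1 - x) <= 1 by rewrite -[leRHS]h2 ler_pM2l.
(* Multiplied by 1 - x > 0, the left side is at most 1, while the right side becomes 1 + x^2 (1 - 2
   x) >= 1 because x <= 1/2. *)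
rewrite -(@ler_pM2r _ (1 - x)); last by lra.
apply: (le_trans h4).
have -> : (1 + x + 2 * x ^+ 2) * (1 - x) = 1 + x ^+ 2 * (1 - 2 * x) by ring.
by rewrite lerDl mulr_ge0 ?sqr_ge0 //; lra.
Qed.

Lemma exists_le_average (R : realDomainType) (n : nat) (F : nat -> R) (c : R) :
  (0 < n)%N -> \sum_(v < n) F v <= n%:R * c ->
  exists2 v, (v < n)%N & F v <= c.
Proof.
move=> n0 hF; apply: contrapT => hn; move: hF; apply/negP; rewrite -ltNge.
have -> : n%:R * c = \sum_(v < n) c by rewrite sumr_const card_ord mulr_natl.
apply: ltr_sum; first by apply/hasP; exists (Ordinal n0) => //; rewrite mem_index_enum.
move=> i _; rewrite ltNge; apply/negP => hi; apply: hn; by exists i.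
Qed.

(** One step of a Hoeffding bound: in the quadratic estimate of the exponentials the linear term
    averages to 0, and 1 + 2 (l B)^2 is turned into an exponential so that successive steps
    multiply. *)
Lemma sum_expR_le (R : realType) (n : nat) (g : nat -> R) (s l B : R) :
  0 <= l -> l * B <= 1 / 2 -> (forall v, `|g v| <= B) ->
  \sum_(v < n) g v = 0 ->
  \sum_(v < n) expR (l * (s + g v)) <=
    n%:R * (expR (l * s) * expR (2 * (l * B) ^+ 2)).
Proof.
move=> l0 lB hg sg.
have lgB v : `|l * g v| <= l * B by rewrite normrM (ger0_norm l0) ler_wpM2l.
have h v : expR (l * (s + g v)) <=
    expR (l * s) * (1 + 2 * (l * B) ^+ 2) + expR (l * s) * l * g v.
  rewrite mulrDr expRD -mulrA -mulrDr ler_pM2l ?expR_gt0 //.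
  apply: (le_trans (expR_le_quadratic _)); first exact: le_trans (lgB v) lB.
  have : (l * g v) ^+ 2 <= (l * B) ^+ 2.
    by rewrite -(real_normK (num_real (l * g v))) lerXn2r ?nnegrE // (le_trans _ (lgB v)).
  by lra.
apply: le_trans; first by apply: ler_sum => v _; exact: h.
rewrite big_split /= sumr_const card_ord -mulr_sumr sg mulr0 addr0 -[leLHS]mulr_natl.
apply: ler_wpM2l => //; apply: ler_wpM2l; first exact: expR_ge0.
exact: expR_ge1Dx.
Qed.

(* Each h i is chosen so that the sum of the exponentials, averaged over the offset,
   does not exceed its mean: the method of conditional expectations. *)
Lemma derandomize_potential (R : realType) (I : finType) (n : nat) (g : nat -> nat -> I -> R)
    (l B : R) :
  (0 < n)%N -> 0 <= l -> l * B <= 1 / 2 ->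
  (forall i v k, `|g i v k| <= B) -> (forall i k, \sum_(v < n) g i v k = 0) ->
  forall P : nat, exists h : nat -> nat, (forall i, (h i < n)%N) /\
    \sum_k (expR (l * \sum_(i < P) g i (h i) k)
            + expR (l * \sum_(i < P) - g i (h i) k))
    <= (2 * #|I|)%:R * expR (2 * (l * B) ^+ 2) ^+ P.
Proof.
move=> n0 l0 lB gB g0; elim=> [|P [h [hn IH]]].
  exists (fun=> 0%N); split=> //.
  rewrite expr0 mulr1 (eq_bigr (fun=> 2)) => [|k _]; last first.
    by rewrite !big_ord0 mulr0 expR0.
  by rewrite sumr_const -mulrnA.
set S := fun k => \sum_(i < P) g i (h i) k in IH.
pose F v := \sum_k (expR (l * (S k + g P v k)) + expR (l * (- S k - g P v k))).
set q := expR (2 * (l * B) ^+ 2) in IH *.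
have [] := @exists_le_average R n F ((2 * #|I|)%:R * q ^+ P.+1) n0.
  rewrite /F exchange_big /=.
  apply: (@le_trans _ _ (\sum_(k : I) n%:R * ((expR (l * S k) + expR (l * - S k)) * q))).
    apply: ler_sum => k _; rewrite big_split /= mulrDl mulrDr; apply: lerD.
      exact: (@sum_expR_le R n (fun v => g P v k)).
    apply: (@sum_expR_le R n (fun v => - g P v k)) => //.
      by move=> v; rewrite normrN.
    by rewrite sumrN g0 oppr0.
  rewrite -mulr_sumr -mulr_suml; apply: ler_wpM2l => //; rewrite exprSr mulrA.
  apply: ler_wpM2r; first exact: expR_ge0.
  apply: le_trans IH; apply: ler_sum => k _.
  by rewrite sumrN.
move=> v vn Fv; exists (fun i => if i == P then v else h i); split.
  by move=> i; case: ifP.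
apply: le_trans Fv; apply: ler_sum => k _.
have E : \sum_(i < P) g i (if nat_of_ord i == P then v else h i) k = S k.
  by apply: eq_bigr => i _; rewrite ltn_eqF.
by rewrite !sumrN !big_ord_recr /= eqxx E opprD.
Qed.

Lemma derandomize (R : realType) (I : finType) (n P : nat) (g : nat -> nat -> I -> R) (B : R) :
  (0 < n)%N -> (0 < P)%N -> 0 < B ->
  (forall i v k, `|g i v k| <= B) -> (forall i k, \sum_(v < n) g i v k = 0) ->
  exists h : nat -> nat, (forall i, (h i < n)%N) /\
    forall k, `|\sum_(i < P) g i (h i) k|
      <= 2 * B * Num.sqrt P%:R * (ln (2 * #|I|)%:R + 1 / 2).
Proof.
move=> n0 P0 B0 gB g0.
have sP : 1 <= Num.sqrt P%:R :> R by rewrite -[leLHS]sqrtr1 ler_sqrt // ?ler1n // ltr0n.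
have sP2 : Num.sqrt P%:R ^+ 2 = P%:R :> R by rewrite sqr_sqrtr.
set r := Num.sqrt P%:R in sP sP2 *.
(* With this l the P step factors multiply to expR (1 / 2), and l B <= 1/2 because P >= 1. The
   potential bounds each of its terms, so a logarithm leaves ln (2 #|I|) + 1/2, the 2 counting both
   signs. *)
pose l := (2 * B * r)^-1 : R.
have r0 : 0 < r by lra.
have l0 : 0 < l by rewrite invr_gt0 !mulr_gt0.
have lE : l * B = (2 * r)^-1 by rewrite /l; field; rewrite !gt_eqF.
have lB : l * B <= 1 / 2.
  by rewrite lE div1r lef_pV2 ?posrE ?mulr_gt0 //; lra.
have [h [hn hS]] := @derandomize_potential R I n g l B n0 (ltW l0) lB gB g0 P.
exists h; split=> // k.
set S := \sum_(i < P) g i (h i) k.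
have eP : expR (2 * (l * B) ^+ 2) ^+ P = expR (1 / 2).
  rewrite -expRM_natl lE -sP2; congr expR; field; by rewrite gt_eqF.
rewrite eP in hS.
have K0 : 0 < (2 * #|I|)%:R :> R by rewrite ltr0n muln_gt0 /=; apply/card_gt0P; exists k.
have key x : expR (l * x) <= (2 * #|I|)%:R * expR (1 / 2) ->
    x <= 2 * B * r * (ln (2 * #|I|)%:R + 1 / 2).
  move=> hx; have : l * x <= ln (2 * #|I|)%:R + 1 / 2.
    by rewrite -(expRK (1/2)) -lnM ?posrE ?expR_gt0 // -[leLHS]expRK ler_ln // posrE ?mulr_gt0 ?expR_gt0.
  move=> h1; rewrite -(@ler_pM2l _ l) //; apply: (le_trans h1).
  by rewrite [leRHS]mulrA /l mulVf ?mul1r // gt_eqF // !mulr_gt0.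
have hk : expR (l * S) + expR (l * - S) <= (2 * #|I|)%:R * expR (1 / 2).
  apply: le_trans hS; rewrite (bigD1 k) //= -/S sumrN lerDl.
  by apply: sumr_ge0 => j _; rewrite addr_ge0 ?expR_ge0.
have := expR_ge0 (l * S); have := expR_ge0 (l * - S) => e1 e2.
rewrite ler_norml; apply/andP; split.
  by rewrite lerNl; apply: key; lra.
by apply: key; lra.
Qed.

(* With v the random offset of a node, this is its contribution to the change of a
   Fourier sum when the tree is refined by one level. *)
Definition shift_dev (R : realType) (n t : nat) (F : nat -> R) (v : nat) : R :=
  t%:R^-1 * (\sum_(s < t) F ((s + v) %% n)%N) - n%:R^-1 * (\sum_(u < n) F u).

Lemma mean_le (R : realType) (n : nat) (F : nat -> R) (c : R) :
  0 <= c -> (forall v, (v < n)%N -> `|F v| <= c) ->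
  `|n%:R^-1 * \sum_(v < n) F v| <= c.
Proof.
move=> c0 hF; have [->|n0] := posnP n; first by rewrite invr0 mul0r normr0.
rewrite normrM ger0_norm ?invr_ge0 // ler_pdivrMl ?ltr0n //.
apply: (le_trans (ler_norm_sum _ _ _)).
have -> : n%:R * c = \sum_(v < n) c by rewrite sumr_const card_ord mulr_natl.
by apply: ler_sum => v _; exact: hF.
Qed.

Lemma sum_shift_mod (R : realType) (n : nat) (F : nat -> R) (s : nat) :
  \sum_(v < n) F ((s + v) %% n)%N = \sum_(v < n) F v.
Proof.
case: n => [|n]; first by rewrite !big_ord0.
elim: s => [|s IH]; first by apply: eq_bigr => v _; rewrite add0n modn_small.
rewrite -IH big_ord_recr [RHS]big_ord_recl /= addrC addSnnS modnDr addn0.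
by congr (_ + _); apply: eq_bigr => v _; rewrite /bump /= add1n addnS.
Qed.

(** Over all n offsets every child is kept equally often, namely t times. This is the mean zero
    hypothesis of [derandomize]. *)
Lemma sum_shift_dev (R : realType) (n t : nat) (F : nat -> R) :
  (0 < n)%N -> (0 < t)%N -> \sum_(v < n) shift_dev n t F v = 0.
Proof.
move=> n0 t0; rewrite /shift_dev big_split /= -mulr_sumr exchange_big /=.
rewrite (eq_bigr (fun=> \sum_(u < n) F u)) => [|s _]; last exact: sum_shift_mod.
rewrite !sumr_const !card_ord; set S := \sum_(u < n) F u.
by rewrite -[S *+ t]mulr_natl mulKf ?mulNrn -?[(_ * S) *+ n]mulr_natl ?mulVKf ?subrr // pnatr_eq0 -lt0n.
Qed.

Lemma shift_devB (R : realType) (n t : nat) (F G : nat -> R) (v : nat) :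
  shift_dev n t F v - shift_dev n t G v = shift_dev n t (fun u => F u - G u) v.
Proof. by rewrite /shift_dev !sumrB; ring. Qed.

Lemma shift_dev_lin (R : realType) (n t : nat) (a b : R) (F G : nat -> R) (v : nat) :
  shift_dev n t (fun u => a * F u + b * G u) v =
  a * shift_dev n t F v + b * shift_dev n t G v.
Proof. by rewrite /shift_dev !big_split /= -!mulr_sumr; ring. Qed.

Lemma eq_shift_dev (R : realType) (n t : nat) (F G : nat -> R) (v : nat) :
  F =1 G -> shift_dev n t F v = shift_dev n t G v.
Proof. by move=> FG; congr (shift_dev _ _ _ _); exact/funext. Qed.

Lemma shift_dev_le (R : realType) (n t : nat) (F : nat -> R) (v : nat) (c : R) :
  (0 < n)%N -> 0 <= c -> (forall u, (u < n)%N -> `|F u| <= c) ->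
  `|shift_dev n t F v| <= 2 * c.
Proof.
move=> n0 c0 hF; rewrite /shift_dev (le_trans (ler_normB _ _)) // mulr_natl mulr2n.
apply: lerD; last exact: mean_le.
by apply: (@mean_le _ _ (fun s => F ((s + v) %% n)%N)) => // s _; apply: hF; rewrite ltn_mod.
Qed.

Lemma cos_lipschitz (R : realType) (x y : R) : `|cos x - cos y| <= `|x - y|.
Proof.
wlog xy : x y / x <= y.
  move=> H; have [/H//|/ltW/H] := leP x y.
  by rewrite distrC [leRHS]distrC.
have [->|nxy] := eqVneq x y; first by rewrite !subrr.
have lxy : x < y by rewrite lt_neqAle nxy.
have dc c : c \in `]x, y[%R -> is_derive c 1 cos (- sin c) by move=> _; exact: is_derive_cos.
have cc : {within `[x, y], continuous (@cos R)}.
  by apply: continuous_subspaceT => z; exact: continuous_cos.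
have [c _ E] := MVT lxy dc cc.
rewrite distrC E normrM normrN distrC ler_piMl //; exact: sin_max.
Qed.

Lemma cosD_2piMn (R : realType) (x : R) (m : nat) : cos (x + 2 * pi * m%:R) = cos x.
Proof.
have -> : 2 * pi * m%:R = (pi *+ 2) *+ m :> R by rewrite mulr_natr mulr_natl.
exact: (periodicn (@cosD2pi R)).
Qed.

Lemma natr_modn (R : realType) (k m : nat) :
  k%:R = (k %/ m)%:R * m%:R + (k %% m)%:R :> R.
Proof. by rewrite -natrM -natrD -divn_eq. Qed.

(* The sum is periodic in eta because the frequencies are integers over Q, and it is
   Lipschitz, so finitely many values of eta suffice; the two phases 0 and pi/2
   determine all theta. *)
Lemma level_choice (R : realType) (n t P Q : nat) (A : nat -> nat) :
  (0 < n)%N -> (0 < t)%N -> (0 < P)%N ->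
  (forall i v, (v < n)%N -> (n * A i + v < Q)%N) ->
  exists h : nat -> nat, (forall i, (h i < n)%N) /\
  forall eta theta : R,
    `|\sum_(i < P) shift_dev n t
        (fun u => cos (eta * ((n * A i + u)%N%:R / Q%:R) + theta)) (h i)|
    <= Num.sqrt P%:R * (8 * ln (4 * P * Q)%:R + 20).
Proof.
move=> n0 t0 P0 AQ.
have Q0 : (0 < Q)%N by exact: leq_ltn_trans (AQ 0%N 0%N n0).
have P0' : 0 < P%:R :> R by rewrite ltr0n.
have Q0' : 0 < Q%:R :> R by rewrite ltr0n.
pose f eta theta i u : R := cos (eta * ((n * A i + u)%N%:R / Q%:R) + theta).
pose ph (b : bool) : R := if b then pi / 2 else 0.
pose net (k : nat) : R := 2 * pi * k%:R / P%:R.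
pose g i v (k : 'I_(P * Q) * bool) := shift_dev n t (f (net k.1) (ph k.2) i) v.
have [] := @derandomize R ('I_(P * Q) * bool)%type n P g 2 n0 P0 (ltr0Sn _ _).
- move=> i v k; rewrite -[leRHS]mulr1; apply: shift_dev_le => // u _; exact: cos_max.
- by move=> i k; exact: sum_shift_dev.
move=> h [hn hS]; exists h; split=> // eta theta.
rewrite card_prod card_ord card_bool in hS.
pose T e th := \sum_(i < P) shift_dev n t (f e th i) (h i).
rewrite -/(T eta theta).
have sP : 1 <= Num.sqrt P%:R :> R by rewrite -[leLHS]sqrtr1 ler_sqrt // ?ler1n // ltr0n.
have netT th (k : nat) : T (net k) th = T (net (k %% (P * Q))%N) th.
  apply: eq_bigr => i _; apply: eq_shift_dev => u; rewrite /f.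
  rewrite -[RHS](cosD_2piMn _ ((k %/ (P * Q)) * (n * A i + u))); congr cos.
  rewrite /net [in LHS](natr_modn R k (P * Q)) !natrM.
  by field; rewrite !gt_eqF.
have phase e th : `|T e th| <= `|T e 0| + `|T e (pi / 2)|.
  have -> : T e th = cos th * T e 0 + sin th * T e (pi / 2).
    rewrite /T !mulr_sumr -big_split /=; apply: eq_bigr => i _.
    rewrite -shift_dev_lin; apply: eq_shift_dev => u.
    by rewrite /f cosDpihalf addr0 cosD; ring.
  rewrite (le_trans (ler_normD _ _)) // lerD // normrM ler_piMl //.
    exact: cos_max.
  exact: sin_max.
have netB k th : `|T (net k) th| <= 8 * Num.sqrt P%:R * (ln (4 * P * Q)%:R + 1 / 2).
  have kPQ : (k %% (P * Q) < P * Q)%N by rewrite ltn_mod muln_gt0 P0.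
  have b0 := hS (Ordinal kPQ, false); have b1 := hS (Ordinal kPQ, true).
  have E4 : (2 * (P * Q * 2) = 4 * P * Q)%N by lia.
  rewrite E4 in b0 b1.
  rewrite netT (le_trans (phase _ _)) //.
  apply: (le_trans (lerD b0 b1)); lra.
have pos th e : 0 <= e -> `|T e th| <= Num.sqrt P%:R * (8 * ln (4 * P * Q)%:R + 20).
  move=> e0; pose k := Num.truncn (e * P%:R / (2 * pi)).
  have pi0 := pi_gt0 R.
  have /andP[k1 k2] : k%:R <= e * P%:R / (2 * pi) < k.+1%:R.
    by apply: truncn_itv; rewrite !mulr_ge0 ?invr_ge0 // mulr_ge0 // ltW.
  (* Neighbouring points of the net differ by 2 pi / P <= 8 / P, so each of the P deviations moves
     by at most 16 / P. The total 16 and the 8 * (1 / 2) of [netB] make the constant 20, as sqrt P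
     >= 1. *)
  have lip : `|T e th - T (net k) th| <= 16.
    rewrite -sumrB (le_trans (ler_norm_sum _ _ _)) //.
    apply: (@le_trans _ _ (\sum_(i < P) 16 / P%:R)); last first.
      by rewrite sumr_const card_ord -[_ *+ P]mulr_natr divfK // gt_eqF.
    apply: ler_sum => i _; rewrite shift_devB.
    have -> : 16 / P%:R = 2 * (8 / P%:R) :> R by ring.
    apply: shift_dev_le => // u un; rewrite /f.
    apply: (le_trans (cos_lipschitz _ _)).
    have -> : e * ((n * A i + u)%N%:R / Q%:R) + th - (net k * ((n * A i + u)%N%:R / Q%:R) + th)
       = (e - net k) * ((n * A i + u)%N%:R / Q%:R) by ring.
    have q1 : (n * A i + u)%N%:R / Q%:R <= 1 :> R.
      by rewrite ler_pdivrMr // mul1r ler_nat ltnW // AQ.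
    have q0 : 0 <= (n * A i + u)%N%:R / Q%:R :> R by rewrite mulr_ge0 ?invr_ge0.
    have e1 : 0 <= e - net k.
      by rewrite subr_ge0 /net ler_pdivrMr // mulrC -ler_pdivlMr ?mulr_gt0.
    have e2 : e - net k <= 8 / P%:R.
      rewrite ler_pdivlMr // mulrBl /net divfK ?gt_eqF //.
      move: k2; rewrite ltr_pdivrMr ?mulr_gt0 // -natr1 => k2.
      have := pihalf_lt2 R; lra.
    rewrite normrM !ger0_norm //.
    by rewrite -[leRHS]mulr1 ler_pM.
  have := netB k th; have := ler_normD (T e th - T (net k) th) (T (net k) th).
  rewrite subrK; nra.
have [e0|e0] := leP 0 eta; first exact: pos.
have -> : T eta theta = T (- eta) (- theta).
  apply: eq_bigr => i _; apply: eq_shift_dev => u; rewrite /f -cosN; congr cos; ring.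
by apply: pos; rewrite oppr_ge0 ltW.
Qed.

(** * The Cantor tree *)

(* The i-th interval of level N, i < t^N, is [cell N i, cell N i + 1] / n^N; its
   children are the intervals i t + s of level N + 1, s < t. *)
Fixpoint cell (n t : nat) (h : nat -> nat -> nat) (N i : nat) : nat :=
  if N is N'.+1 then
    (n * cell n t h N' (i %/ t) + (i %% t + h N' (i %/ t)) %% n)%N
  else 0%N.

Lemma cell_lt (n t : nat) (h : nat -> nat -> nat) (N i : nat) :
  (0 < n)%N -> (cell n t h N i < n ^ N)%N.
Proof.
move=> n0; elim: N i => [|N IH] i //=; rewrite expnS.
have /= := IH (i %/ t)%N; have := ltn_pmod (i %% t + h N (i %/ t))%N n0; nia.
Qed.

(** A cyclic block of t <= n residues modulo n has no repetition, so the last base n digit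
    determines i modulo t once i / t is known by induction. *)
Lemma cell_inj (n t : nat) (h : nat -> nat -> nat) (N i j : nat) :
  (0 < t)%N -> (t <= n)%N -> (i < t ^ N)%N -> (j < t ^ N)%N ->
  cell n t h N i = cell n t h N j -> i = j.
Proof.
move=> t0 tn; have n0 : (0 < n)%N := leq_trans t0 tn.
elim: N i j => [|N IH] i j; first by rewrite expn0; lia.
rewrite expnSr => it jt /= E.
have m1 := ltn_pmod (i %% t + h N (i %/ t))%N n0.
have m2 := ltn_pmod (j %% t + h N (j %/ t))%N n0.
have [E1 E2] : cell n t h N (i %/ t)%N = cell n t h N (j %/ t)%N /\
    ((i %% t + h N (i %/ t)) %% n = (j %% t + h N (j %/ t)) %% n)%N.
  have key x y p q : (p < n -> q < n -> n * x + p = n * y + q -> x = y /\ p = q)%N.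
    move=> pn qn Exy; have [xy|xy|xy] := ltngtP x y; last by subst y; split; lia.
      by exfalso; have := leq_mul (leqnn n) xy; rewrite mulnS; lia.
    by exfalso; have := leq_mul (leqnn n) xy; rewrite mulnS; lia.
  exact: key E.
have E3 : (i %/ t = j %/ t)%N by apply: IH; rewrite ?ltn_divLR.
move/eqP: E2; rewrite E3 eqn_modDr !(modn_small (leq_trans (ltn_pmod _ t0) tn)) => /eqP E4.
by rewrite (divn_eq i t) (divn_eq j t) E3 E4.
Qed.

(** Level N has P = t^N nodes and positions of denominator Q = n^(N+1), so the term ln (4 P Q) of
    [level_choice] is linear in N; this is the factor N + 1. *)
Lemma exists_digits (R : realType) (n t : nat) :
  (0 < t)%N -> (t <= n)%N ->
  exists h : nat -> nat -> nat, exists2 c : R, 0 <= c &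
    (forall N i, (h N i < n)%N) /\
    forall (N : nat) (eta theta : R),
      `|\sum_(i < t ^ N) shift_dev n t
        (fun u => cos (eta * ((n * cell n t h N i + u)%N%:R / (n ^ N.+1)%:R) + theta))
        (h N i)| <= c * N.+1%:R * Num.sqrt (t ^ N)%:R.
Proof.
move=> t0 tn; have n0 : (0 < n)%N := leq_trans t0 tn.
pose c : R := 8 * (ln 4 + 2 * ln n%:R) + 20.
have ln0 : 0 <= ln n%:R :> R by rewrite ln_ge0 // ler1n.
have l40 : 0 <= ln 4 :> R by rewrite ln_ge0 // ler1n.
(* The offsets of a level depend on its cells, which depend on all earlier offsets. So offsets are
   chosen for every pair of a level and a map of cells, and the recursion [A] below feeds the choice
   with its own cells. *)
have /choice[H HP] (NA : nat * (nat -> nat)) : exists h : nat -> nat,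
    (forall i, (h i < n)%N) /\
    ((forall i, (NA.2 i < n ^ NA.1)%N) -> forall eta theta : R,
      `|\sum_(i < t ^ NA.1) shift_dev n t
        (fun u => cos (eta * ((n * NA.2 i + u)%N%:R / (n ^ NA.1.+1)%:R) + theta))
        (h i)| <= c * NA.1.+1%:R * Num.sqrt (t ^ NA.1)%:R).
  case: NA => N A /=.
  have [AN|AN] := pselect (forall i, (A i < n ^ N)%N); last by exists (fun=> 0%N).
  have [||h [hn hS]] := @level_choice R n t (t ^ N) (n ^ N.+1) A n0 t0.
  - by rewrite expn_gt0 t0.
  - by move=> i v vn; have := AN i; rewrite expnS; nia.
  exists h; split=> // _ eta theta; apply: (le_trans (hS eta theta)).
  rewrite mulrC ler_wpM2r ?sqrtr_ge0 //.
  have tN : (4 * t ^ N * n ^ N.+1)%:R <= 4 * n%:R ^+ (N + N.+1) :> R.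
    rewrite exprD mulrA -!natrX -!natrM ler_nat leq_mul2r leq_mul2l.
    have -> : (t ^ N <= n ^ N)%N by elim: {AN} (N) => // k IH; rewrite !expnS leq_mul.
    by rewrite !orbT.
  have pN : 0 < (4 * t ^ N * n ^ N.+1)%:R :> R.
    by rewrite ltr0n !muln_gt0 !expn_gt0 t0 n0.
  have nN : 0 < n%:R ^+ (N + N.+1) :> R by rewrite exprn_gt0 // ltr0n.
  have lnN : ln (4 * t ^ N * n ^ N.+1)%:R <= ln 4 + (N + N.+1)%:R * ln n%:R :> R.
    by rewrite mulr_natl -lnXn ?ltr0n // -lnM ?posrE // ler_ln // posrE mulr_gt0.
  apply: (@le_trans _ _ (8 * (ln 4 + (N + N.+1)%:R * ln n%:R) + 20)); first by lra.
  rewrite /c natrD -natr1; have := ler0n R N; nra.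
pose fix A (N : nat) : nat -> nat := if N is N'.+1 then
    fun i => (n * A N' (i %/ t) + (i %% t + H (N', A N') (i %/ t)) %% n)%N
  else fun=> 0%N.
pose h N := H (N, A N).
have cA N : cell n t h N =1 A N by elim: N => [|N IH] i //=; rewrite IH.
have hn N i : (h N i < n)%N := (HP (N, A N)).1 i.
exists h, c; first by rewrite /c; lra.
split=> // N eta theta; have [_ /= HN] := HP (N, A N).
have := HN _ eta theta; under eq_bigr => i _ do under eq_fun => u do rewrite -cA.
by apply=> i; rewrite -cA; exact: cell_lt.
Qed.

(* Mean of cos over [x, x + e], in a closed form that needs no integral. *)
Definition mean_cos (R : realType) (e x : R) : R := (sin (x + e) - sin x) / e.

Lemma mean_cosE (R : realType) (e x : R) : e != 0 ->
  mean_cos e x = 2 / e * sin (e / 2) * cos (x + e / 2).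
Proof.
move=> e0; rewrite /mean_cos.
have -> : x + e = x + e / 2 + e / 2 by lra.
have {2}-> : x = x + e / 2 - e / 2 by lra.
by rewrite sinD sinB; field.
Qed.

Lemma mean_cos_split (R : realType) (n : nat) (e x : R) : (0 < n)%N ->
  mean_cos e x = n%:R^-1 * \sum_(v < n) mean_cos (e / n%:R) (x + v%:R * (e / n%:R)).
Proof.
move=> n0; have n0' : n%:R != 0 :> R by rewrite pnatr_eq0 -lt0n.
rewrite /mean_cos -mulr_suml.
have -> : \sum_(v < n) (sin (x + v%:R * (e / n%:R) + e / n%:R) - sin (x + v%:R * (e / n%:R)))
    = sin (x + e) - sin x.
  pose G (v : nat) := sin (x + v%:R * (e / n%:R)).
  rewrite (eq_bigr (fun v : 'I_n => G v.+1 - G v)) => [|v _]; last first.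
    by rewrite /G -natr1 mulrDl mul1r addrA.
  rewrite -(big_mkord xpredT (fun v => G v.+1 - G v)) telescope_sumr //.
  by rewrite /G mul0r addr0 mulrC divfK.
by rewrite invfM invrK [e^-1 * _]mulrC [_ * (n%:R * _)]mulrCA mulKf.
Qed.

Lemma mean_cos_near (R : realType) (e x y : R) :
  0 < e -> x <= y <= x + e -> `|mean_cos e x - cos y| <= e.
Proof.
move=> e0 xye; have lx : x < x + e by lra.
have ds c : c \in `]x, (x + e)[%R -> is_derive c 1 sin (cos c) by move=> _; exact: is_derive_sin.
have cs : {within `[x, x + e], continuous (@sin R)}.
  by apply: continuous_subspaceT => z; exact: continuous_sin.
have [c + E] := MVT lx ds cs; rewrite in_itv /= => cxe.
have -> : mean_cos e x = cos c.
  rewrite /mean_cos E; have -> : x + e - x = e by lra.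
  by rewrite mulfK // gt_eqF.
apply: (le_trans (cos_lipschitz _ _)); rewrite ler_norml; lra.
Qed.

Lemma sin_le_norm (R : realType) (x : R) : `|sin x| <= `|x|.
Proof.
by have := cos_lipschitz (x - pi / 2) (0 - pi / 2); rewrite !cosBpihalf sin0 subr0 opprB addrA subrK subr0.
Qed.

(** Interpolation between the bounds 1 and c. For c = 2 / e it merges the two elementary bounds of
    the factor 2 / e * sin (e / 2) into one power. *)
Lemma le1_powR (R : realType) (x c y g : R) :
  0 <= g <= 1 -> 0 < c -> 0 <= y -> y <= 1 -> y <= c -> y <= c `^ g.
Proof.
move=> /andP[g0 g1] c0 y0 y1 yc; have [c1|c1] := leP c 1.
  apply: (le_trans yc); rewrite -[leLHS](powRr1 (ltW c0)).
  by rewrite ger_powR // c0.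
apply: (le_trans y1); rewrite -[leLHS](powRr0 c).
by rewrite ler_powR // ltW.
Qed.

Lemma sum_nat_muln (R : nmodType) (P t : nat) (F : nat -> R) :
  \sum_(i < P * t) F i = \sum_(i < P) \sum_(s < t) F (i * t + s)%N.
Proof.
elim: P => [|P IH]; first by rewrite !big_ord0.
by rewrite mulSnr big_split_ord /= IH big_ord_recr.
Qed.

(* Integral of cos (eta x + theta) against the uniform measure on the level N intervals. *)
Definition level_cos (R : realType) (n t : nat) (h : nat -> nat -> nat) (N : nat)
    (eta theta : R) : R :=
  (t ^ N)%:R^-1 * \sum_(i < t ^ N)
    mean_cos (eta / (n ^ N)%:R) (eta * ((cell n t h N i)%:R / (n ^ N)%:R) + theta).

(** Refinement replaces the average over all n children by the average over the t kept ones. All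
    children have the same length, so by [mean_cosE] a common factor splits off and cosines at
    midpoints remain; the midpoints shift the phase by e / 2. *)
Lemma level_cos_step (R : realType) (n t : nat) (h : nat -> nat -> nat) (N : nat)
    (eta theta : R) : (0 < n)%N -> (0 < t)%N -> eta != 0 ->
  let e := eta / (n ^ N.+1)%:R in
  level_cos n t h N.+1 eta theta - level_cos n t h N eta theta =
  (t ^ N)%:R^-1 * (2 / e * sin (e / 2)) * \sum_(i < t ^ N) shift_dev n t
        (fun u => cos (eta * ((n * cell n t h N i + u)%N%:R / (n ^ N.+1)%:R)
                       + (theta + e / 2))) (h N i).
Proof.
move=> n0 t0 eta0 e; rewrite /level_cos.
have nN : (n ^ N)%:R != 0 :> R by rewrite pnatr_eq0 -lt0n expn_gt0 n0.
have n0' : n%:R != 0 :> R by rewrite pnatr_eq0 -lt0n.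
have t0' : t%:R != 0 :> R by rewrite pnatr_eq0 -lt0n.
have tN : (t ^ N)%:R != 0 :> R by rewrite pnatr_eq0 -lt0n expn_gt0 t0.
have nNS : (n ^ N.+1)%:R = n%:R * (n ^ N)%:R :> R by rewrite expnS natrM.
have e0 : e != 0 by rewrite mulf_neq0 // invr_eq0 nNS mulf_neq0.
pose F k := mean_cos e (eta * ((cell n t h N.+1 k)%:R / (n ^ N.+1)%:R) + theta).
rewrite -/e (_ : \sum_(i < t ^ N.+1) _ = \sum_(i < t ^ N) \sum_(s < t) F (i * t + s)%N); last first.
  by rewrite -sum_nat_muln -expnSr.
rewrite expnSr natrM invfM -!mulrA -mulrBr; congr (_ * _).
rewrite mulr_sumr -sumrB !mulrA mulr_sumr; apply: eq_bigr => i _.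
rewrite (@mean_cos_split _ n) // /shift_dev mulrBr; congr (_ - _).
  rewrite [RHS]mulrCA; congr (_ * _); rewrite mulr_sumr; apply: eq_bigr => s _.
  rewrite /F /= divnMDl // (divn_small (ltn_ord s)) addn0 modnMDl (modn_small (ltn_ord s)) -/e mean_cosE //.
  by rewrite addrA.
rewrite [RHS]mulrCA; congr (_ * _); rewrite mulr_sumr; apply: eq_bigr => v _.
have -> : eta / (n ^ N)%:R / n%:R = e by rewrite /e nNS; field; rewrite ?nN ?n0'.
rewrite mean_cosE //; congr (_ * cos _).
by rewrite natrD natrM /e nNS; field; rewrite ?nN ?n0'.
Qed.

Lemma sum_arith_geom_le (R : realType) (x : R) (L : nat) : 0 <= x < 1 ->
  \sum_(N < L) N.+1%:R * x ^+ N <= (1 - x) ^- 2.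
Proof.
move=> /andP[x0 x1].
have E : (1 - x) ^+ 2 * \sum_(N < L) N.+1%:R * x ^+ N
    = 1 - (1 + L%:R * (1 - x)) * x ^+ L.
  elim: L => [|L IH]; first by rewrite big_ord0 expr0; lra.
  by rewrite big_ord_recr /= mulrDr IH [x ^+ L.+1]exprS -natr1; ring.
have x2 : 0 < (1 - x) ^+ 2 by rewrite exprn_gt0 // subr_gt0.
rewrite -(ler_pM2l x2) E mulfV ?gt_eqF // gerBl mulr_ge0 ?exprn_ge0 //.
by rewrite addr_ge0 // mulr_ge0 // subr_ge0 ltW.
Qed.

(** Telescoping over the levels: the step at level L is at most a constant times eta^(-g) (L + 1)
    x^L with x = n^g / sqrt t < 1, which is summable, so the bound is uniform in N. The power n^(g
    L) comes from estimating the common factor of [level_cos_step] by (2 n^(L+1) / eta)^g. *)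
Lemma level_cos_decay (R : realType) (n t : nat) (h : nat -> nat -> nat) (c g : R) :
  (0 < n)%N -> (0 < t)%N -> 0 <= c -> 0 <= g <= 1 ->
  n%:R `^ g < Num.sqrt t%:R ->
  (forall (N : nat) (eta theta : R),
      `|\sum_(i < t ^ N) shift_dev n t
        (fun u => cos (eta * ((n * cell n t h N i + u)%N%:R / (n ^ N.+1)%:R) + theta))
        (h N i)| <= c * N.+1%:R * Num.sqrt (t ^ N)%:R) ->
  exists2 D : R, 0 <= D & forall (N : nat) (eta theta : R), 0 < eta ->
    `|level_cos n t h N eta theta| <= D * eta `^ (- g).
Proof.
move=> n0 t0 c0 g01 ng hS.
have /andP[g0 g1] := g01.
have n0' : 0 < n%:R :> R by rewrite ltr0n.
have st0 : 0 < Num.sqrt t%:R :> R by rewrite sqrtr_gt0 ltr0n.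
pose x : R := n%:R `^ g / Num.sqrt t%:R.
have x01 : 0 <= x < 1.
  by rewrite /x ltr_pdivrMr // mul1r ng mulr_ge0 ?powR_ge0 ?invr_ge0 ?ltW.
exists (2 `^ g + c * (2 * n%:R) `^ g * (1 - x) ^- 2).
  rewrite addr_ge0 ?powR_ge0 // !mulr_ge0 ?powR_ge0 // invr_ge0 exprn_ge0 //; lra.
move=> N eta theta eta0.
have eta0' : eta != 0 by rewrite gt_eqF.
have sinc_le e : 0 < e -> `|2 / e * sin (e / 2)| <= (2 / e) `^ g.
  move=> e0; apply: le1_powR => //; first by rewrite divr_gt0.
  - rewrite normrM gtr0_norm ?divr_gt0 // mulrC -ler_pdivlMr ?divr_gt0 // mul1r.
    apply: (le_trans (sin_le_norm _)); rewrite invf_div gtr0_norm ?divr_gt0 //.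
  - rewrite normrM gtr0_norm ?divr_gt0 // ler_piMr ?sin_max // ltW // divr_gt0 //.
have split_pow (y : R) : 0 < y -> (y / eta) `^ g = y `^ g * eta `^ (- g).
  move=> y0; rewrite powRM ?ltW ?invr_gt0 // -powR_inv1 ?ltW // -powRrM mulN1r.
  by [].
have step L : `|level_cos n t h L.+1 eta theta - level_cos n t h L eta theta|
    <= c * (2 * n%:R) `^ g * eta `^ (- g) * (L.+1%:R * x ^+ L).
  rewrite level_cos_step //.
  set e := eta / (n ^ L.+1)%:R.
  have nL : 0 < (n ^ L.+1)%:R :> R by rewrite ltr0n expn_gt0 n0.
  have tL : 0 < (t ^ L)%:R :> R by rewrite ltr0n expn_gt0 t0.
  have e0 : 0 < e by rewrite divr_gt0.
  rewrite 2!normrM gtr0_norm ?invr_gt0 //.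
  apply: (@le_trans _ _ ((t ^ L)%:R^-1 * (2 / e) `^ g * (c * L.+1%:R * Num.sqrt (t ^ L)%:R))).
    apply: ler_pM => //.
    by apply: ler_wpM2l; [rewrite invr_ge0 ltW|exact: sinc_le].
  have -> : 2 / e = (2 * n%:R) * n%:R ^+ L / eta.
    by rewrite /e expnS natrM natrX; field; rewrite ?eta0' ?expf_neq0 ?gt_eqF.
  rewrite split_pow ?mulr_gt0 ?exprn_gt0 // [(_ * n%:R ^+ L) `^ g]powRM ?exprn_ge0 //.
  have -> : (n%:R ^+ L) `^ g = (n%:R `^ g) ^+ L :> R.
    by rewrite -!powR_mulrn ?powR_ge0 ?ltW // -!powRrM mulrC.
  have -> : Num.sqrt (t ^ L)%:R = Num.sqrt t%:R ^+ L :> R.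
    by rewrite natrX; elim: (L) => [|k IH]; rewrite ?sqrtr1 // !exprS sqrtrM // IH.
  have -> : (t ^ L)%:R = (Num.sqrt t%:R ^+ L) ^+ 2 :> R.
    by rewrite natrX -exprM mulnC exprM sqr_sqrtr.
  rewrite /x expr_div_n le_eqVlt; apply/orP; left; apply/eqP.
  by field; rewrite ?expf_neq0 ?gt_eqF.
have L0 : `|level_cos n t h 0 eta theta| <= 2 `^ g * eta `^ (- g).
  rewrite /level_cos !expn0 big_ord1 /= invr1 mul1r !mulr1 mean_cosE //.
  rewrite normrM (le_trans (ler_piMr _ (cos_max _))) // -split_pow //.
  exact: sinc_le.
have tele : `|level_cos n t h N eta theta| <= 2 `^ g * eta `^ (- g) +
   \sum_(L < N) c * (2 * n%:R) `^ g * eta `^ (- g) * (L.+1%:R * x ^+ L).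
  elim: N => [|N IH]; first by rewrite big_ord0 addr0.
  rewrite big_ord_recr /= addrA.
  have := ler_normD (level_cos n t h N eta theta)
    (level_cos n t h N.+1 eta theta - level_cos n t h N eta theta).
  rewrite addrCA subrr addr0 => /le_trans; apply.
  by apply: lerD; [exact: IH|exact: step].
apply: (le_trans tele); rewrite -mulr_sumr [leRHS]mulrDl; apply: lerD => //.
rewrite [leRHS]mulrAC; apply: ler_wpM2l; last exact: sum_arith_geom_le.
by rewrite !mulr_ge0 ?powR_ge0.
Qed.

(** * The Salem measure *)

Definition code_approx (R : realType) (n t : nat) (h : nat -> nat -> nat) (N : nat) (u : R) : R :=
  (cell n t h N (Num.truncn (u * (t ^ N)%:R)))%:R / (n ^ N)%:R.

(* The image of Lebesgue measure on [0, 1[ under this map is nu. *)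
Definition code (R : realType) (n t : nat) (h : nat -> nat -> nat) (u : R) : R :=
  limn (fun N => code_approx n t h N u).

Lemma truncn_muln_divn (R : realType) (t : nat) (u : R) : (0 < t)%N ->
  (Num.truncn (u * t%:R) %/ t)%N = Num.truncn u.
Proof.
move=> t0; have t0' : 0 < t%:R :> R by rewrite ltr0n.
have [u0|u0] := leP 0 u; last first.
  have -> : Num.truncn (u * t%:R) = 0%N.
    by apply/eqP; rewrite -leqn0 truncn_le_nat (lt_le_trans _ ler01) // nmulr_rlt0.
  rewrite div0n; apply/esym/eqP; rewrite -leqn0 truncn_le_nat; lra.
apply/esym/truncn_def; have /andP[h1 h2] := truncn_itv u0.
have ut0 : 0 <= u * t%:R by rewrite mulr_ge0.
have /andP[k1 k2] := truncn_itv ut0.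
set k := Num.truncn (u * t%:R) in k1 k2 *.
apply/andP; split.
  rewrite -(ler_pM2r t0') (le_trans _ k1) // -natrM ler_nat.
  exact: leq_trunc_div.
rewrite -(ltr_pM2r t0') (lt_le_trans k2) // -natrM ler_nat.
by rewrite -ltn_divLR.
Qed.

(** The intervals of length n^(-N) selected by u are nested: left endpoints increase and right
    endpoints decrease. Convergence and [code_bounds] follow. *)
Lemma code_approx_step (R : realType) (n t : nat) (h : nat -> nat -> nat) (N : nat) (u : R) :
  (0 < n)%N -> (0 < t)%N ->
  code_approx n t h N u <= code_approx n t h N.+1 u /\
  code_approx n t h N.+1 u + (n ^ N.+1)%:R^-1 <= code_approx n t h N u + (n ^ N)%:R^-1.
Proof.
move=> n0 t0; rewrite /code_approx.
have nN : 0 < (n ^ N)%:R :> R by rewrite ltr0n expn_gt0 n0.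
have n0' : 0 < n%:R :> R by rewrite ltr0n.
set k := Num.truncn (u * (t ^ N.+1)%:R).
have E : (k %/ t)%N = Num.truncn (u * (t ^ N)%:R).
  by rewrite /k expnSr natrM mulrA truncn_muln_divn.
rewrite /= E; set a := cell _ _ _ _ _; set v := (X in (_ + X)%N).
have vn : (v < n)%N by rewrite ltn_pmod.
rewrite expnS natrM natrD natrM.
have vn' : v%:R + 1 <= n%:R :> R by rewrite natr1 ler_nat.
have v0 : 0 <= v%:R :> R by [].
have -> : (n%:R * a%:R + v%:R) / (n%:R * (n ^ N)%:R) = a%:R / (n ^ N)%:R + v%:R / (n%:R * (n ^ N)%:R) :> R.
  by field; rewrite !gt_eqF.
have -> : (n ^ N)%:R^-1 = n%:R / (n%:R * (n ^ N)%:R) :> R by field; rewrite !gt_eqF.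
have nn : 0 < (n%:R * (n ^ N)%:R)^-1 :> R by rewrite invr_gt0 mulr_gt0.
split; first by rewrite lerDl mulr_ge0 // ltW.
by rewrite -addrA lerD2l -[X in _ + X]mul1r -mulrDl ler_pM2r.
Qed.

Lemma code_approx_mono (R : realType) (n t : nat) (h : nat -> nat -> nat) (u : R) (N M : nat) :
  (0 < n)%N -> (0 < t)%N -> (N <= M)%N ->
  code_approx n t h N u <= code_approx n t h M u /\
  code_approx n t h M u + (n ^ M)%:R^-1 <= code_approx n t h N u + (n ^ N)%:R^-1.
Proof.
move=> n0 t0 /subnKC <-; elim: (M - N)%N => [|k [IH1 IH2]]; first by rewrite addn0.
rewrite addnS; have [h1 h2] := code_approx_step h (N + k) u n0 t0.
by split; [exact: le_trans h1|exact: le_trans IH2].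
Qed.

Lemma code_approx_cvg (R : realType) (n t : nat) (h : nat -> nat -> nat) (u : R) :
  (0 < n)%N -> (0 < t)%N -> code_approx n t h N u @[N --> \oo] --> code n t h u.
Proof.
move=> n0 t0; apply: nondecreasing_is_cvgn.
  by move=> N M NM; have [] := code_approx_mono h u n0 t0 NM.
exists (code_approx n t h 0 u + (n ^ 0)%:R^-1) => _ [M _ <-].
have [_] := code_approx_mono h u n0 t0 (leq0n M); apply: le_trans.
by rewrite lerDl invr_ge0.
Qed.

Lemma code_bounds (R : realType) (n t : nat) (h : nat -> nat -> nat) (N : nat) (u : R) :
  (0 < n)%N -> (0 < t)%N ->
  code_approx n t h N u <= code n t h u <= code_approx n t h N u + (n ^ N)%:R^-1.
Proof.
move=> n0 t0; have cv := @code_approx_cvg R n t h u n0 t0; apply/andP; split.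
  apply: limr_ge; first by apply/cvg_ex; exists (code n t h u).
  by exists N => // M /= NM; have [] := code_approx_mono h u n0 t0 NM.
apply: limr_le; first by apply/cvg_ex; exists (code n t h u).
exists N => // M /= NM; have [_] := code_approx_mono h u n0 t0 NM; apply: le_trans.
by rewrite lerDl invr_ge0.
Qed.

Lemma measurable_truncn_comp (R : realType) (g : nat -> R) (m : nat) :
  measurable_fun [set: measurableTypeR R] (fun u : R => g (Num.truncn (u * m%:R))).
Proof.
move=> _ Y mY; rewrite setTI.
have -> : (fun u : R => g (Num.truncn (u * m%:R))) @^-1` Y =
   \bigcup_(k in [set k | Y (g k)]) ((fun u : R => u * m%:R) @^-1` (@Num.truncn R @^-1` [set k])).
  apply/seteqP; split => u /=.
    by move=> Yu; exists (Num.truncn (u * m%:R)).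
  by move=> [k Yk /= ->].
apply: bigcup_measurable => k Yk; rewrite -[X in measurable X]setTI.
have mk : measurable (@Num.truncn R @^-1` [set k]).
  have -> : @Num.truncn R @^-1` [set k] = [set x | (k <= Num.truncn x)%N] `\` [set x | (k < Num.truncn x)%N].
    apply/seteqP; split => x /=; first by move=> ->; rewrite leqnn ltnn.
    by move=> [kx /negP]; rewrite -leqNgt => xk; apply/eqP; rewrite eqn_leq xk.
  have mlt j : measurable ([set x : R | (j < Num.truncn x)%N]).
    rewrite (_ : [set x | _] = `[j.+1%:R, +oo[%classic) ?measurable_itv //.
    by apply/seteqP; split => x; rewrite /= truncn_gt_nat in_itv /= andbT.
  apply: measurableD => //; case: k {Yk} => [|k]; last exact: mlt.
  by rewrite (_ : [set x | _] = setT) //; apply/seteqP; split.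
exact: mulrr_measurable.
Qed.

Lemma measurable_code (R : realType) (n t : nat) (h : nat -> nat -> nat) :
  (0 < n)%N -> (0 < t)%N ->
  measurable_fun [set: measurableTypeR R] (code n t h : R -> R).
Proof.
move=> n0 t0; apply: (@measurable_fun_cvg _ _ R setT (fun N u => code_approx n t h N u)).
  by move=> N; exact: (@measurable_truncn_comp R (fun k => (cell n t h N k)%:R / (n ^ N)%:R)).
by move=> u _; exact: code_approx_cvg.
Qed.

Definition uni01 (R : realType) : set (measurableTypeR R) -> \bar R :=
  mrestr (@lebesgue_measure R) (measurable_itv `[(0 : R), 1[).

HB.instance Definition _ (R : realType) := Measure.on (@uni01 R).

Lemma uni01_setT (R : realType) : uni01 (setT : set R) = 1%E.
Proof.
by rewrite /uni01 /mrestr setTI lebesgue_measure_itv /= lte_fin ltr01 sube0.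
Qed.

HB.instance Definition _ (R : realType) :=
  Measure_isProbability.Build _ _ _ (@uni01 R) (uni01_setT R).

Lemma uni01_truncn (R : realType) (P i : nat) : (0 < P)%N ->
  (uni01 [set u : R | Num.truncn (u * P%:R) = i] <= (P%:R^-1)%:E)%E.
Proof.
move=> P0; have P0' : 0 < P%:R :> R by rewrite ltr0n.
apply: (@le_trans _ _ (lebesgue_measure (`[i%:R / P%:R, i.+1%:R / P%:R[%classic : set R))).
  rewrite /uni01 /mrestr; apply: le_measure; rewrite ?inE.
  - apply: measurableI => //.
    have := @measurable_truncn_comp R (fun k => (k == i)%:R) P measurableT [set 1] (measurable_set1 _).
    rewrite setTI; congr (measurable _); apply/seteqP; split => u /=.
      by case: eqP => // _ /esym/eqP; rewrite oner_eq0.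
    by move=> ->; rewrite eqxx.
  - exact: measurable_itv.
  - move=> u [/= <-]; rewrite !in_itv /= => /andP[u0 u1].
    have := @truncn_itv R (u * P%:R); rewrite mulr_ge0 // => /(_ isT).
    by rewrite -ler_pdivrMr // -ltr_pdivlMr.
rewrite lebesgue_measure_itv /= lte_fin ltr_pM2r ?invr_gt0 // ltr_nat ltnSn.
by rewrite -EFinB lee_fin -mulrBl -natr1 addrAC subrr add0r mul1r.
Qed.

Lemma integral_uni01_le (R : realType) (P : nat) (G : R -> R) (c : nat -> R) :
  (0 < P)%N -> measurable_fun [set: measurableTypeR R] G ->
  (forall u, 0 <= G u) -> (forall i, 0 <= c i) ->
  (forall u, 0 <= u < 1 -> G u <= c (Num.truncn (u * P%:R))) ->
  (\int[@uni01 R]_u (G u)%:E <= (P%:R^-1 * \sum_(i < P) c i)%:E)%E.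
Proof.
move=> P0 mG G0 c0 Gc; have P0' : 0 < P%:R :> R by rewrite ltr0n.
pose A i := [set u : measurableTypeR R | Num.truncn (u * P%:R) = i].
have mA i : measurable (A i).
  have := @measurable_truncn_comp R (fun k => (k == i)%:R) P measurableT [set 1] (measurable_set1 _).
  rewrite setTI; congr (measurable _); apply/seteqP; split => u /=.
    by case: eqP => // _ /esym/eqP; rewrite oner_eq0.
  by move=> ->; rewrite eqxx.
pose H (u : measurableTypeR R) : \bar R := (\sum_(i < P) ((c i)%:E * (\1_(A i) u)%:E))%E.
have mH i : measurable_fun [set: measurableTypeR R] (fun u => ((c i)%:E * (\1_(A i) u)%:E)%E).
  by apply: emeasurable_funM => //; apply/measurable_EFinP; exact: measurable_indic.
have H0 i u : (0 <= (c i)%:E * (\1_(A i) u)%:E)%E.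
  by rewrite -EFinM lee_fin mulr_ge0.
apply: (@le_trans _ _ (\int[@uni01 R]_u H u)%E).
  apply: ae_ge0_le_integral => //.
  - by move=> u _; rewrite lee_fin.
  - exact/measurable_EFinP.
  - by move=> u _; apply: sume_ge0 => i _; exact: H0.
  - by apply: emeasurable_sum => i.
  (* The pointwise bound is available on [0, 1[ only; [uni01] does not charge the complement. *)
  exists (~` `[0, 1[); split; first by apply: measurableC; exact: measurable_itv.
    by change (lebesgue_measure (~` `[(0:R), 1[%classic `&` `[(0:R), 1[) = 0%E); rewrite setICl measure0.
  move=> u /= hu; apply: contra_not hu => /[!in_itv] /= u01 _.
  have uP : (Num.truncn (u * P%:R) < P)%N.
    case/andP: u01 => u0 u1; rewrite truncn_lt_nat ?mulr_ge0 //.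
    by rewrite -[ltRHS]mul1r ltr_pM2r.
  rewrite /H (bigD1 (Ordinal uP)) //= indicE mem_set // mule1.
  rewrite -[leLHS]adde0; apply: leeD; first by rewrite lee_fin; exact: Gc.
  by apply: sume_ge0 => i _; exact: H0.
rewrite ge0_integral_sum //.
rewrite mulr_sumr -sumEFin; apply: lee_sum => i _.
rewrite ge0_integralZl_EFin //; last first.
  by apply/measurable_EFinP; exact: measurable_indic.
rewrite integral_indic // setIT mulrC EFinM; apply: lee_pmul => //.
  by rewrite lee_fin.
exact: uni01_truncn.
Qed.

Lemma sum_inj_le (R : realDomainType) (P Q : nat) (c : nat -> nat) (F : nat -> R) :
  (forall i, (i < P)%N -> (c i < Q)%N) ->
  (forall i j, (i < P)%N -> (j < P)%N -> c i = c j -> i = j) ->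
  (forall k, 0 <= F k) ->
  \sum_(i < P) F (c i) <= \sum_(k < Q) F k.
Proof.
move=> cQ cI F0; pose f (i : 'I_P) := Ordinal (cQ i (ltn_ord i)).
have fI : {in [set: 'I_P]%SET &, injective f}.
  by move=> i j _ _ /(congr1 val) /= E; apply/val_inj; exact: (cI _ _ (ltn_ord i) (ltn_ord j) E).
rewrite [leRHS](bigID [in (f @: [set: 'I_P])%SET]) /= big_imset //=.
rewrite [X in _ <= X + _](eq_bigl xpredT) => [|i]; last by rewrite finset.in_setT.
by rewrite lerDl sumr_ge0.
Qed.

Lemma count_nat_interval_le (R : realDomainType) (Q : nat) (a b : R) :
  0 <= b - a + 1 -> \sum_(k < Q) (if a <= k%:R <= b then 1 else 0) <= b - a + 1.
Proof.
move=> ab.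
(* The bound b - a + 1 is not inductive in Q; the count truncated at Q is. *)
suff : \sum_(k < Q) (if a <= k%:R <= b then 1 else 0) <= Num.max 0 (Num.min (b + 1) Q%:R - a).
  rewrite /Num.max /Num.min; case: ifP => _; last by lra.
  by case: ifP => //; lra.
elim: Q => [|Q IH]; first by rewrite big_ord0 le_max lexx.
rewrite big_ord_recr /= -natr1; move: IH; set S := \sum_(k < Q) _.
rewrite !le_max => IH.
have [/andP[aQ Qb]|_] := boolP (a <= Q%:R <= b).
  apply/orP; right; rewrite lerBrDr le_min; apply/andP; split.
    by case/orP: IH => IH; [lra|move: IH; rewrite lerBrDr le_min => /andP[]; lra].
  by case/orP: IH => IH; [lra|move: IH; rewrite lerBrDr le_min => /andP[]; lra].
rewrite addr0; case/orP: IH => IH; first by rewrite IH.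
apply/orP; right; move: IH; rewrite !lerBrDr !le_min => /andP[-> h] /=; lra.
Qed.

Lemma lt1_ltr_powR (R : realType) (a x y : R) : 1 < a -> x < y -> a `^ x < a `^ y.
Proof.
move=> a1 xy; have a0 : 0 < a by lra.
by rewrite /powR gt_eqF // ltr_expR ltr_pM2r // ln_gt0.
Qed.

Lemma uni01_full (R : realType) (A : set (measurableTypeR R)) : measurable A ->
  (forall u : R, 0 <= u < 1 -> A u) -> uni01 A = 1%E.
Proof.
move=> mA hA; rewrite -(uni01_setT R) /uni01 /mrestr setTI; congr (lebesgue_measure _).
by apply/seteqP; split => u /=; [case|move=> hu; split=> //; apply: hA; move: hu; rewrite in_itv].
Qed.

Lemma exists_scale (R : realType) (n : nat) (r : R) : (1 < n)%N -> 0 < r <= 1 ->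
  exists N : nat, (n ^ N.+1)%:R^-1 < r <= (n ^ N)%:R^-1.
Proof.
move=> n1 /andP[r0 r1].
have ex : exists N : nat, (n ^ N)%:R^-1 < r.
  exists (Num.truncn r^-1).+1.
  rewrite invf_plt ?posrE ?ltr0n ?expn_gt0 ?(ltnW n1) //.
  apply: (lt_trans (truncnS_gt _)); rewrite ltr_nat; exact: ltn_expl.
have [[|N] hN minN] := ex_minnP ex; first by move: hN; rewrite expn0 invr1; lra.
exists N; rewrite hN /= leNgt; apply/negP => /minN; lia.
Qed.

Lemma le_all_addn (R : realType) (x y e : R) (n : nat) : (1 < n)%N -> 0 <= e ->
  (forall N : nat, x <= y + e / (n ^ N)%:R) -> x <= y.
Proof.
move=> n1 e0 H; apply/ler_addgt0Pr => d d0.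
pose N := (Num.truncn (e / d)).+1.
apply: (le_trans (H N)); rewrite lerD2l.
have nN : 0 < (n ^ N)%:R :> R by rewrite ltr0n expn_gt0 (ltnW n1).
rewrite ler_pdivrMr // mulrC -ler_pdivrMr //.
apply/ltW/(lt_trans (truncnS_gt _)); rewrite ltr_nat; exact: ltn_expl.
Qed.

Definition code_cell (R : realType) (n t : nat) (h : nat -> nat -> nat) (N i : nat) : R :=
  (cell n t h N i)%:R / (n ^ N)%:R.

Lemma measurable_cos_affine (R : realType) (eta theta : R) :
  measurable_fun [set: measurableTypeR R] (fun x : R => 1 + cos (eta * x + theta)).
Proof.
apply: measurable_funD => //; apply: continuous_measurable_fun => x.
apply: (@continuous_comp _ _ _ (fun x => eta * x + theta) cos); last exact: continuous_cos.
by apply: cvgD; [apply: cvgM; [exact: cvg_cst|exact: cvg_id]|exact: cvg_cst].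
Qed.

Lemma cosD1_ge0 (R : realType) (x : R) : 0 <= 1 + cos x.
Proof. by have := cos_geN1 x; lra. Qed.

(* Integrating 1 + cos >= 0 keeps everything nonnegative; the lower bound on the
   integral of cos comes for free by replacing theta with theta + pi. *)
Lemma code_fourier_le (R : realType) (n t : nat) (h : nat -> nat -> nat)
    (eta theta B : R) : (1 < n)%N -> (0 < t)%N -> 0 < eta ->
  (forall N, `|level_cos n t h N eta theta| <= B) ->
  (\int[@uni01 R]_u (1 + cos (eta * code n t h u + theta))%:E <= (1 + B)%:E)%E.
Proof.
move=> n1 t0 eta0 HB; have n0 : (0 < n)%N := ltnW n1.
set I := (X in (X <= _)%E).
have IN N : (I <= (1 + B + eta / (n ^ N)%:R)%:E)%E.
  have nN : 0 < (n ^ N)%:R :> R by rewrite ltr0n expn_gt0 n0.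
  have tN : 0 < (t ^ N)%:R :> R by rewrite ltr0n expn_gt0 t0.
  pose e := eta / (n ^ N)%:R; have e0 : 0 < e by rewrite divr_gt0.
  pose x i := eta * code_cell R n t h N i + theta.
  pose c i := 1 + mean_cos e (x i) + e.
  apply: (@le_trans _ _ ((t ^ N)%:R^-1 * \sum_(i < t ^ N) c i)%:E).
    apply: integral_uni01_le.
    - by rewrite expn_gt0 t0.
    - apply: (measurableT_comp (measurable_cos_affine eta theta)).
      exact: measurable_code.
    - by move=> u; exact: cosD1_ge0.
    - move=> i; have := @mean_cos_near R e (x i) (x i) e0; rewrite lexx lerDl (ltW e0).
      by move=> /(_ isT); rewrite ler_norml /c; have := cosD1_ge0 (x i); lra.
    - move=> u _; rewrite /c.
      have /andP[b1 b2] := code_bounds h N u n0 t0.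
      have := @mean_cos_near R e (x (Num.truncn (u * (t ^ N)%:R))) (eta * code n t h u + theta) e0.
      rewrite ler_norml => H.
      have /H : x (Num.truncn (u * (t ^ N)%:R)) <= eta * code n t h u + theta <=
          x (Num.truncn (u * (t ^ N)%:R)) + e.
        rewrite /x /e -addrAC !lerD2r -mulrDr !ler_pM2l //.
        by apply/andP.
      lra.
  rewrite lee_fin /c 2!big_split /= !sumr_const card_ord.
  rewrite -[1 *+ _]mulr_natr -[e *+ _]mulr_natr !mulrDr mul1r mulVf ?gt_eqF //.
  rewrite [X in _ + X](_ : _ = e); last by rewrite mulrCA mulVf ?mulr1 // gt_eqF.
  rewrite lerD2r lerD2l; apply: (le_trans _ (HB N)).
  exact: ler_norm.
have I0 : (0 <= I)%E by apply: integral_ge0 => u _; rewrite lee_fin; exact: cosD1_ge0.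
move: I0 IN; case: I => [r| |] //; last first.
  by move=> _ /(_ 0%N); rewrite leye_eq.
move=> _ IN; rewrite lee_fin; apply: (@le_all_addn _ _ _ eta n) => [||N] //; first exact: ltW.
by have := IN N; rewrite lee_fin.
Qed.

(** Each interval of level N has mass at most t^(-N), and a segment of length 2 r <= 2 n^(-N) meets
    at most 2 n^N r + 2 <= 4 of them. *)
Lemma code_interval_le (R : realType) (n t : nat) (h : nat -> nat -> nat) (N : nat) (x r : R) :
  (0 < t)%N -> (t <= n)%N -> 0 < r <= (n ^ N)%:R^-1 ->
  (uni01 (code n t h @^-1` `[(x - r)%R, (x + r)%R]) <= (4 / (t ^ N)%:R)%:E)%E.
Proof.
move=> t0 tn /andP[r0 rN]; have n0 : (0 < n)%N := leq_trans t0 tn.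
have nN : 0 < (n ^ N)%:R :> R by rewrite ltr0n expn_gt0 n0.
have tN : 0 < (t ^ N)%:R :> R by rewrite ltr0n expn_gt0 t0.
set A := _ @^-1` _.
have mA : measurable (A : set (measurableTypeR R)).
  have := @measurable_code R n t h n0 t0 measurableT _ (measurable_itv `[x - r, x + r]).
  by rewrite setTI.
(* A cell extends one unit to the right of its index, hence the - 1 in [a]. *)
pose a := (n ^ N)%:R * (x - r) - 1; pose b := (n ^ N)%:R * (x + r).
pose F (k : nat) : R := if a <= k%:R <= b then 1 else 0.
rewrite -[uni01 A](_ : (\int[@uni01 R]_u (\1_A u)%:E)%E = _); last by rewrite integral_indic ?setIT.
apply: (@le_trans _ _ ((t ^ N)%:R^-1 * \sum_(i < t ^ N) F (cell n t h N i))%:E).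
  apply: (@integral_uni01_le R (t ^ N) (\1_A) (fun i => F (cell n t h N i))) => //.
  - by rewrite expn_gt0 t0.
  - by move=> i; rewrite /F; case: ifP.
  move=> u u01; rewrite indicE; case: (boolP (u \in A)) => [|_]; last by rewrite /F; case: ifP.
  rewrite inE /A /= in_itv /= => /andP[c1 c2]; rewrite /F.
  have /andP[] := code_bounds h N u n0 t0; rewrite /code_approx.
  set k := cell _ _ _ _ _ => b1 b2.
  rewrite ifT //; apply/andP; split.
    rewrite /a lerBlDr mulrC -ler_pdivlMr // mulrDl mul1r; lra.
  by rewrite /b mulrC -ler_pdivrMr //; lra.
rewrite lee_fin mulrC ler_pM2r ?invr_gt0 //.
apply: (@le_trans _ _ (\sum_(k < n ^ N) F k)).
  apply: sum_inj_le.
  - by move=> i _; exact: cell_lt.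
  - by move=> i j iP jP; exact: cell_inj.
  - by move=> k; rewrite /F; case: ifP.
have rn : (n ^ N)%:R * r <= 1 by rewrite mulrC -ler_pdivlMr // mul1r.
have nr0 : 0 < (n ^ N)%:R * r by rewrite mulr_gt0.
have E : b - a + 1 = 2 * ((n ^ N)%:R * r) + 2 by rewrite /a /b; ring.
apply: (le_trans (count_nat_interval_le _ _)); rewrite E; lra.
Qed.

(** Here [a N i] is the left endpoint of the i-th interval of level N; the rest of the proof sees
    the tree only through it. Comparing r <= 1 with the scale n^(-N-1) < r <= n^(-N) costs the
    factor t in the Frostman bound. Taking beta < alpha makes n^(beta/2) < sqrt t strict, as
    [level_cos_decay] requires. *)
Lemma salem_measure (R : realType) (n t : nat) (alpha : R) :
  (1 < n)%N -> (0 < t)%N -> (t <= n)%N -> 0 < alpha <= 1 ->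
  n%:R `^ alpha = t%:R ->
  exists (nu : probability (measurableTypeR R) R) (a : nat -> nat -> R),
    [/\ nu `[(0:R), 1]%classic = 1%E,
        forall N, nu (\big[setU/set0]_(i < t ^ N) `[a N i, (a N i + (n ^ N)%:R^-1)%R]%classic) = 1%E,
        forall x r : R, 0 < r -> (nu `[(x - r)%R, (x + r)%R]%classic <= (4 * t%:R * r `^ alpha)%:E)%E &
        forall beta, 0 < beta < alpha -> exists2 D : R, 0 <= D & forall eta theta : R, 0 < eta ->
          (\int[nu]_x (1 + cos (eta * x + theta))%:E <= (1 + D * eta `^ (- (beta / 2)))%:E)%E].
Proof.
move=> n1 t0 tn /andP[a0 a1] ntE.
have n0 : (0 < n)%N := ltnW n1.
have [h [c c0 [hn hS]]] := exists_digits R t0 tn.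
have mcode : @measurable_fun _ _ (measurableTypeR R) (measurableTypeR R) setT (code n t h).
  exact: measurable_code.
pose mcode_mixin := isMeasurableFun.Build _ _ _ _ _ mcode.
pose codef : {mfun measurableTypeR R >-> measurableTypeR R} := HB.pack (code n t h : R -> R) mcode_mixin.
pose nu : probability (measurableTypeR R) R := distribution (@uni01 R) codef.
have lvl N u : 0 <= u < 1 -> (\big[setU/set0]_(i < t ^ N)
     `[code_cell R n t h N i, code_cell R n t h N i + (n ^ N)%:R^-1]%classic) (code n t h u).
  move=> /andP[u0 u1].
  have uP : (Num.truncn (u * (t ^ N)%:R) < t ^ N)%N.
    rewrite truncn_lt_nat ?mulr_ge0 // -[ltRHS]mul1r ltr_pM2r // ltr0n expn_gt0 t0 //.
  rewrite (bigD1 (Ordinal uP)) //=; left.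
  by rewrite in_itv /=; exact: code_bounds.
have nuE A : nu A = uni01 (code n t h @^-1` A) by [].
have nu1 (A : set (measurableTypeR R)) : measurable A -> (forall u : R, 0 <= u < 1 -> A (code n t h u)) -> nu A = 1%E.
  move=> mA hA; rewrite [nu A]nuE; apply: uni01_full => //.
  by rewrite -[X in measurable X]setTI; exact: (mcode measurableT).
have mlvl N : measurable (\big[setU/set0]_(i < t ^ N)
     `[code_cell R n t h N i, code_cell R n t h N i + (n ^ N)%:R^-1]%classic : set (measurableTypeR R)).
  by apply: bigsetU_measurable => i _; exact: measurable_itv.
exists nu, (code_cell R n t h); split.
- apply: nu1; first exact: measurable_itv.
  move=> u u01; have := lvl 0%N u u01.
  by rewrite expn0 big_ord1 /code_cell /= mul0r expn0 invr1 add0r.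
- by move=> N; apply: nu1 => // u u01; exact: lvl.
- move=> x r r0; have [r1|r1] := leP r 1; last first.
    apply: (@le_trans _ _ 1%E); first exact: probability_le1.
    rewrite lee_fin; have ra : 1 <= r `^ alpha.
      by rewrite -[leLHS](powRr0 r) ler_powR ?ltW.
    have t1 : 1 <= t%:R :> R by rewrite ler1n.
    have : 1 <= t%:R * r `^ alpha by rewrite -[leLHS]mulr1 ler_pM.
    by rewrite -mulrA; lra.
  have [|N /andP[N1 N2]] := @exists_scale R n r n1; first by rewrite r0.
  rewrite nuE; apply: (le_trans (@code_interval_le R n t h N x r t0 tn _)); first by rewrite r0.
  rewrite lee_fin.
  have tN : (t ^ N)%:R != 0 :> R by rewrite pnatr_eq0 -lt0n expn_gt0 t0.
  have t0' : t%:R != 0 :> R by rewrite pnatr_eq0 -lt0n.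
  have -> : 4 / (t ^ N)%:R = 4 * t%:R * ((t ^ N.+1)%:R^-1) :> R.
    by rewrite expnS natrM; field; rewrite ?tN ?t0'.
  apply: ler_wpM2l; first by rewrite mulr_ge0.
  have -> : (t ^ N.+1)%:R^-1 = ((n ^ N.+1)%:R^-1) `^ alpha :> R.
    rewrite !natrX -ntE -[X in X^-1 = _]powR_mulrn ?powR_ge0 // -powRrM -powRN.
    rewrite -[n%:R ^+ _]powR_mulrn // -powRN -powRrM; congr (_ `^ _); ring.
  by apply: ge0_ler_powR; rewrite ?nnegrE ?invr_ge0 //; exact: ltW.
- move=> beta /andP[b0 ba].
  have nb : n%:R `^ (beta / 2) < Num.sqrt t%:R :> R.
    rewrite -ntE -powR12_sqrt ?powR_ge0 // -powRrM.
    by apply: lt1_ltr_powR; rewrite ?ltr1n //; lra.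
  have [|D D0 HD] := @level_cos_decay R n t h c (beta / 2) n0 t0 c0 _ nb hS.
    by apply/andP; split; lra.
  exists D => // eta theta eta0.
  have -> : (\int[nu]_x (1 + cos (eta * x + theta))%:E =
     \int[@uni01 R]_u (1 + cos (eta * code n t h u + theta))%:E)%E.
    rewrite /nu ge0_integral_distribution //.
    by apply/measurable_EFinP; exact: measurable_cos_affine.
  by apply: code_fourier_le => // N; exact: HD.
Qed.

(** * Scaled copies along arithmetic progressions *)

Definition affine (R : realType) (b d : R) (x : measurableTypeR R) : measurableTypeR R := b + d * x.

Lemma measurable_affine (R : realType) (b d : R) :
  measurable_fun [set: measurableTypeR R] (affine b d).
Proof.
apply: (@measurable_funD _ (measurableTypeR R) R); first exact: measurable_cst.
exact: mulrl_measurable.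
Qed.

HB.instance Definition _ (R : realType) (b d : R) :=
  isMeasurableFun.Build _ _ (measurableTypeR R) (measurableTypeR R)
    (affine b d) (measurable_affine b d).

Definition mixture (R : realType) (nu : probability (measurableTypeR R) R)
    (J : nat -> nat) (c : nat -> {nonneg R}) (b d : nat -> R) :
    {measure set (measurableTypeR R) -> \bar R} :=
  mseries (fun l => mscale (c l)
    (msum (fun j => distribution nu (affine (j%:R * b l) (d l))) (J l))) 0.

Lemma mixtureE (R : realType) (nu : probability (measurableTypeR R) R)
    (J : nat -> nat) (c : nat -> {nonneg R}) (b d : nat -> R)
    (A : set (measurableTypeR R)) :
  mixture nu J c b d A = (\sum_(l <oo) ((c l)%:num%:E *
    \sum_(j < J l) nu (affine (j%:R * b l) (d l) @^-1` A)))%E.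
Proof. by []. Qed.

Lemma mixture_integral (R : realType) (nu : probability (measurableTypeR R) R)
    (J : nat -> nat) (c : nat -> {nonneg R}) (b d : nat -> R)
    (g : R -> R) : measurable_fun [set: measurableTypeR R] g -> (forall x, 0 <= g x) ->
  (\int[mixture nu J c b d]_x (g x)%:E = \sum_(l <oo) ((c l)%:num%:E *
    \sum_(j < J l) \int[nu]_x (g (j%:R * b l + d l * x))%:E))%E.
Proof.
move=> mg g0; have mEg : measurable_fun [set: measurableTypeR R] (EFin \o g).
  exact/measurable_EFinP.
have Eg0 x : [set: measurableTypeR R] x -> (0 <= (g x)%:E)%E by rewrite lee_fin.
rewrite ge0_integral_measure_series //; apply: eq_eseriesr => l _.
rewrite ge0_integral_mscale //; congr (_ * _)%E.
rewrite ge0_integral_measure_sum //; apply: eq_bigr => j _.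
rewrite ge0_integral_distribution // => x; exact: Eg0.
Qed.

Lemma mixture_piece_le (R : realType) (nu : probability (measurableTypeR R) R)
    (J : nat -> nat) (c : nat -> {nonneg R}) (b d : nat -> R)
    (A : set (measurableTypeR R)) (l : nat) : measurable A ->
  ((c l)%:num%:E * \sum_(j < J l) nu (affine (j%:R * b l) (d l) @^-1` A)
    <= mixture nu J c b d A)%E.
Proof.
move=> mA.
have mpre k j : measurable (affine (j%:R * b k) (d k) @^-1` A).
  by rewrite -[X in measurable X]setTI; exact: measurable_affine.
have t0 k : (0 <= (c k)%:num%:E *
    \sum_(j < J k) nu (affine (j%:R * b k) (d k) @^-1` A))%E.
  by apply: mule_ge0 => //; apply: sume_ge0 => j _; exact: measure_ge0.
rewrite mixtureE; apply: le_trans (nneseries_lim_ge l.+1 _); last by move=> k _ _; exact: t0.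
rewrite big_nat_recr //= leeDr // sume_ge0 // => k _; exact: t0.
Qed.

Lemma mixture_full (R : realType) (nu : probability (measurableTypeR R) R)
    (J : nat -> nat) (c : nat -> {nonneg R}) (b d : nat -> R)
    (A : set (measurableTypeR R)) :
  (\sum_(l <oo) ((c l)%:num * (J l)%:R)%:E = 1)%E ->
  (forall l j, (j < J l)%N -> nu (affine (j%:R * b l) (d l) @^-1` A) = 1%E) ->
  mixture nu J c b d A = 1%E.
Proof.
move=> c1 hA; rewrite mixtureE -[RHS]c1; apply: eq_eseriesr => l _.
rewrite EFinM; congr (_ * _)%E.
rewrite (eq_bigr (fun=> 1%:E)) => [|j _]; last exact: hA.
by rewrite sumEFin sumr_const card_ord.
Qed.

(** [reps], [gap] and [contraction] are the parameters J, b and d of the l-th piece. They are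
    written with natural powers, so that real exponents enter only through n^alpha = t. *)
Definition reps (t B l : nat) : nat := (t ^ (B * l))%N.

Definition gap (R : realType) (t B l : nat) : R := (2 ^ l * t ^ (B * l))%N%:R^-1.

Definition contraction (R : realType) (n B l : nat) : R := (n ^ (2 * (B * l)))%N%:R^-1.

(* The l-th piece has mass (1 - q) q^l with q = mass_ratio, spread evenly over reps copies. *)
Definition mass_ratio (R : realType) (t B : nat) : R := (2 * t ^ B)%N%:R^-1.

Lemma mass_ratio_bounds (R : realType) (t B : nat) : (0 < t)%N ->
  0 <= mass_ratio R t B <= 1 / 2.
Proof.
move=> t0; rewrite /mass_ratio invr_ge0 ler0n /= div1r lef_pV2 ?posrE ?ltr0n ?muln_gt0 ?expn_gt0 ?t0 //.
by rewrite ler_nat leq_pmulr // expn_gt0 t0.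
Qed.

(* The absolute value only serves to obtain a nonnegative real by construction. *)
Definition copy_mass (R : realType) (t B l : nat) : {nonneg R} :=
  `|(1 - mass_ratio R t B) / (2 ^ l * t ^ (2 * (B * l)))%N%:R|%:nng.

Lemma copy_massE (R : realType) (t B l : nat) : (0 < t)%N ->
  (copy_mass R t B l)%:num = (1 - mass_ratio R t B) / (2 ^ l * t ^ (2 * (B * l)))%N%:R.
Proof.
move=> t0; have := mass_ratio_bounds R B t0 => q01 /=.
by rewrite ger0_norm // mulr_ge0 ?invr_ge0 //; lra.
Qed.

(** Each copy weighs 2^(-l) d^alpha up to the factor 1 - q; multiplied by J this is geometric in l,
    so the total mass is exactly 1. *)
Lemma copy_mass_reps (R : realType) (t B l : nat) : (0 < t)%N ->
  (copy_mass R t B l)%:num * (reps t B l)%:R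
  = (1 - mass_ratio R t B) * mass_ratio R t B ^+ l.
Proof.
move=> t0; rewrite copy_massE // /reps /mass_ratio exprVn -natrX -mulrA; congr (_ * _).
rewrite mul2n -addnn !expnD expnMn -expnM !natrM.
have p2 : (2 ^ l)%:R != 0 :> R by rewrite pnatr_eq0 -lt0n expn_gt0.
have pt : (t ^ (B * l))%:R != 0 :> R by rewrite pnatr_eq0 -lt0n expn_gt0 t0.
by field; rewrite p2 pt.
Qed.

Lemma sum_copy_mass (R : realType) (t B : nat) : (0 < t)%N ->
  (\sum_(l <oo) ((copy_mass R t B l)%:num * (reps t B l)%:R)%:E = 1)%E.
Proof.
move=> t0; have q01 := mass_ratio_bounds R B t0.
have q1 : `|mass_ratio R t B| < 1 by rewrite ger0_norm; lra.
have := @cvg_geometric_series R (1 - mass_ratio R t B) _ q1.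
rewrite divff; last by rewrite subr_eq0 gt_eqF //; lra.
move=> cv; apply/cvg_lim => //.
rewrite (_ : (fun n => _) = EFin \o series (geometric (1 - mass_ratio R t B) (mass_ratio R t B))).
  by apply: cvg_EFin => //; exact: nearW.
apply/funext => N /=; rewrite -sumEFin /series /=; apply: eq_bigr => l _.
by rewrite copy_mass_reps.
Qed.

Lemma copy_mass_le (R : realType) (t B l : nat) : (0 < t)%N ->
  (copy_mass R t B l)%:num <= (2 ^ l)%:R^-1 * (t ^ (2 * (B * l)))%:R^-1 :> R.
Proof.
move=> t0; rewrite copy_massE // natrM invfM ler_piMl //.
by have := mass_ratio_bounds R B t0; lra.
Qed.

Lemma contraction_powR (R : realType) (n t B l : nat) (alpha : R) :
  n%:R `^ alpha = t%:R -> contraction R n B l `^ alpha = (t ^ (2 * (B * l)))%:R^-1.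
Proof.
move=> ntE; rewrite /contraction -powR_inv1 // !natrX -!powR_mulrn // -ntE.
rewrite -!powRrM -powRN; congr (_ `^ _); ring.
Qed.

Lemma contraction_gt0 (R : realType) (n B l : nat) : (0 < n)%N -> 0 < contraction R n B l.
Proof. by move=> n0; rewrite invr_gt0 ltr0n expn_gt0 n0. Qed.

Lemma gap_gt0 (R : realType) (t B l : nat) : (0 < t)%N -> 0 < gap R t B l.
Proof. by move=> t0; rewrite invr_gt0 ltr0n muln_gt0 !expn_gt0 t0. Qed.

Lemma exp2_le_exp (t B l : nat) : (1 < t)%N -> (0 < B)%N -> (2 ^ l <= t ^ (B * l))%N.
Proof.
move=> t1 B0; apply: (@leq_trans (t ^ l)).
  by elim: l => // l IH; rewrite !expnS leq_mul.
by rewrite leq_exp2l // leq_pmull.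
Qed.

Lemma contraction_le_gap (R : realType) (n t B l : nat) : (1 < t)%N -> (t <= n)%N -> (0 < B)%N ->
  contraction R n B l <= gap R t B l.
Proof.
move=> t1 tn B0; have t0 := ltnW t1.
rewrite /contraction /gap lef_pV2 ?posrE ?ltr0n ?muln_gt0 ?expn_gt0 ?t0 ?(leq_trans t0 tn) //.
rewrite ler_nat mul2n -addnn expnD leq_mul //.
  exact: (exp2_le_exp l (leq_trans t1 tn) B0).
by elim: (B * l)%N => // k IH; rewrite !expnS leq_mul.
Qed.

Lemma gapV_le (R : realType) (t B l : nat) : (1 < t)%N -> (0 < B)%N ->
  (t ^ (2 * (B * l)))%:R^-1 * (gap R t B l)^-1 <= 1.
Proof.
move=> t1 B0; have t0 := ltnW t1.
rewrite /gap invrK ler_pdivrMl ?ltr0n ?expn_gt0 ?t0 // mulr1 ler_nat mul2n -addnn expnD leq_mul //.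
exact: exp2_le_exp.
Qed.

(** Copy j lies in [j b, j b + d] with d <= b, so a segment of length 2 r meets at most 2 r / b + 2
    copies, and each of them contributes at most v. *)
Lemma piece_frostman (R : realType) (nu : probability (measurableTypeR R) R)
    (J : nat) (b d x r v : R) :
  nu `[(0:R), 1]%classic = 1%E -> 0 < d <= b -> 0 < r -> 0 <= v ->
  (forall y : R, (nu `[(y - r / d)%R, (y + r / d)%R]%classic <= v%:E)%E) ->
  (\sum_(j < J) nu (affine (j%:R * b) d @^-1` `[(x - r)%R, (x + r)%R]%classic)
    <= (v * (2 * r / b + 2))%:E)%E.
Proof.
move=> nu01 /andP[d0 db] r0 v0 hv; have b0 : 0 < b := lt_le_trans d0 db.
pose F (k : nat) : R := if (x - r - d) / b <= k%:R <= (x + r) / b then 1 else 0.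
apply: (@le_trans _ _ (\sum_(j < J) (v * F j)%:E)%E).
  apply: lee_sum => j _.
  have E : affine (j%:R * b) d @^-1` `[x - r, x + r]%classic
      = `[(x - j%:R * b) / d - r / d, (x - j%:R * b) / d + r / d]%classic.
    apply/seteqP; split => y /=; rewrite !in_itv /= /affine => /andP[y1 y2]; apply/andP; split.
    - by rewrite -mulrBl ler_pdivrMr //; lra.
    - by rewrite -mulrDl ler_pdivlMr //; lra.
    - by move: y1; rewrite -mulrBl ler_pdivrMr //; lra.
    - by move: y2; rewrite -mulrDl ler_pdivlMr //; lra.
  rewrite E; have [hF|hF] := boolP ((x - r - d) / b <= j%:R <= (x + r) / b).
    by rewrite /F hF mulr1; exact: hv.
  rewrite /F (negbTE hF) mulr0.
  have m01 : measurable (`[(0:R), 1]%classic : set (measurableTypeR R)) by exact: measurable_itv.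
  apply: (@le_trans _ _ (nu (~` `[(0:R), 1]%classic))); last first.
    by rewrite probability_setC // nu01 subee.
  apply: le_measure; rewrite ?inE; [exact: measurable_itv|exact: measurableC|].
  move=> y /=; rewrite !in_itv /= => /andP[y1 y2] /andP[z1 z2].
  move/negP: hF; apply; rewrite ler_pdivrMr // ler_pdivlMr //.
  move: y1 y2; rewrite -mulrBl -mulrDl ler_pdivrMr // ler_pdivlMr // => y1 y2.
  have : y * d <= d by rewrite ger_pMl.
  have : 0 <= y * d by rewrite mulr_ge0 // ltW.
  by move=> *; apply/andP; split; lra.
rewrite sumEFin lee_fin -mulr_sumr; apply: ler_wpM2l => //.
have E : (x + r) / b - (x - r - d) / b + 1 = 2 * r / b + (d / b + 1).
  by field; rewrite gt_eqF.
have db1 : d / b <= 1 by rewrite ler_pdivrMr // mul1r.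
have db0 : 0 < d / b by rewrite divr_gt0.
have rb0 : 0 < 2 * r / b by rewrite divr_gt0 // mulr_gt0.
apply: (le_trans (count_nat_interval_le _ _)); rewrite E; lra.
Qed.

Lemma mixture_frostman (R : realType) (nu : probability (measurableTypeR R) R)
    (n t B : nat) (alpha C : R) :
  (1 < t)%N -> (t <= n)%N -> (0 < B)%N -> 0 < alpha <= 1 -> n%:R `^ alpha = t%:R ->
  0 <= C -> nu `[(0:R), 1]%classic = 1%E ->
  (forall x r : R, 0 < r -> (nu `[(x - r)%R, (x + r)%R]%classic <= (C * r `^ alpha)%:E)%E) ->
  forall x r : R, 0 < r <= 1 ->
  (mixture nu (reps t B) (copy_mass R t B) (gap R t B) (contraction R n B)
    `[(x - r)%R, (x + r)%R]%classic <= ((4 + 4 * C) * r `^ alpha)%:E)%E.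
Proof.
move=> t1 tn B0 /andP[a0 a1] ntE C0 nu01 hnu x r /andP[r0 r1].
have t0 := ltnW t1; have n0 : (0 < n)%N := leq_trans t0 tn.
have ra : r <= r `^ alpha.
  rewrite -[leLHS](powRr1 (ltW r0)); apply: ger_powR => //; exact/andP.
have ra0 : 0 <= r `^ alpha := powR_ge0 _ _.
rewrite mixtureE; apply: le_trans; last first.
  (* The l-th piece is granted the share 2^(-l-1) of the bound, which doubles the constant 2 + 2 C
     found below for a single piece. *)
  apply: (@epsilon_trick0 R ((4 + 4 * C) * r `^ alpha) xpredT).
  by rewrite mulr_ge0 //; lra.
apply: lee_nneseries => [l _ _|l _].
  apply: mule_ge0 => //; apply: sume_ge0 => j _; exact: measure_ge0.
set T := (t ^ (2 * (B * l)))%:R : R.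
have T0 : 0 < T by rewrite ltr0n expn_gt0 t0.
set b := gap R t B l; have b0 : 0 < b := gap_gt0 R B l t0.
set d := contraction R n B l; have d0 : 0 < d := contraction_gt0 R B l n0.
have da : d `^ alpha = T^-1 := contraction_powR B l ntE.
pose w := C * (r / d) `^ alpha.
have w0 : 0 <= w by rewrite mulr_ge0 // powR_ge0.
have wE : w = C * r `^ alpha * T.
  have dV : d^-1 `^ alpha = T.
    by rewrite -powR_inv1 ?(ltW d0) // powRAC da powR_inv1 ?invrK // invr_ge0 ltW.
  by rewrite /w powRM ?(ltW r0) // ?invr_ge0 ?(ltW d0) // dV mulrA.
pose v := Num.min 1 w.
have v0 : 0 <= v by rewrite /v le_min ler01.
have vw : v <= w by rewrite /v ge_min lexx orbT.
have v1 : v <= 1 by rewrite /v ge_min lexx.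
have hv (y : R) : (nu `[(y - r / d)%R, (y + r / d)%R]%classic <= v%:E)%E.
  rewrite /v EFin_min le_min; apply/andP; split; first exact: probability_le1.
  by apply: hnu; rewrite divr_gt0.
have h1 : 0 < d <= b by rewrite d0; exact: contraction_le_gap.
have hp := piece_frostman (reps t B l) x nu01 h1 r0 v0 hv.
apply: (@le_trans _ _ (((2 ^ l)%:R^-1 * T^-1)%:E * (v * (2 * r / b + 2))%:E)%E).
  apply: lee_pmul => //.
  - by apply: sume_ge0 => j _; exact: measure_ge0.
  - by rewrite lee_fin; exact: copy_mass_le.
rewrite -EFinM lee_fin.
have Tb : T^-1 * b^-1 <= 1 := gapV_le R l t1 B0.
have p2 : 0 < (2 ^ l)%:R :> R by rewrite ltr0n expn_gt0.
have -> : (4 + 4 * C) * r `^ alpha / (2 ^ l.+1)%:R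
    = (2 ^ l)%:R^-1 * ((2 + 2 * C) * r `^ alpha).
  by rewrite expnS natrM; field; rewrite gt_eqF.
rewrite -[leLHS]mulrA; apply: ler_wpM2l; first by rewrite invr_ge0 ltW.
(* The bound v <= 1 serves for the first term and v <= w for the second. Multiplied by T^(-1) =
   d^alpha they become at most 2 r <= 2 r^alpha, since T^(-1) b^(-1) <= 1, and 2 C r^alpha. *)
have e1 : v * (2 * r / b + 2) <= 2 * r / b + 2 * w.
  have rb0 : 0 < 2 * r / b by rewrite divr_gt0 // mulr_gt0.
  nra.
apply: (@le_trans _ _ (T^-1 * (2 * r / b + 2 * w))).
  by apply: ler_wpM2l; [rewrite invr_ge0 ltW|].
have -> : T^-1 * (2 * r / b + 2 * w) = 2 * r * (T^-1 * b^-1) + 2 * C * r `^ alpha.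
  by rewrite wE; field; rewrite !gt_eqF.
nra.
Qed.

Lemma contraction_powRN (R : realType) (n B l : nat) (beta : R) :
  contraction R n B l `^ (- (beta / 2)) = (n%:R `^ beta) ^+ (B * l).
Proof.
rewrite /contraction natrX -(powR_invn _ (ler0n R n)).
rewrite -(powR_mulrn _ (powR_ge0 _ _)) -powRrM -powRrM.
by congr (_ `^ _); rewrite natrM; field.
Qed.

(** Translating a copy only changes theta; scaling it replaces eta by eta d and costs d^(-beta/2) =
    n^(beta B l) <= t^(B l) = J. The l-th piece has total mass at most 2^(-l) / J, so the cost is
    cancelled and the factors 2^(-l) sum to 2. *)
Lemma mixture_fourier (R : realType) (nu : probability (measurableTypeR R) R)
    (n t B : nat) (beta D : R) :
  (0 < t)%N -> (0 < n)%N -> 0 <= beta -> 0 <= D -> n%:R `^ beta <= t%:R ->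
  (forall eta theta : R, 0 < eta ->
    (\int[nu]_x (1 + cos (eta * x + theta))%:E <= (1 + D * eta `^ (- (beta / 2)))%:E)%E) ->
  forall eta theta : R, 0 < eta ->
  (\int[mixture nu (reps t B) (copy_mass R t B) (gap R t B) (contraction R n B)]_x
      (1 + cos (eta * x + theta))%:E <= (1 + 2 * D * eta `^ (- (beta / 2)))%:E)%E.
Proof.
move=> t0 n0 b0 D0 nbt hnu eta theta eta0.
rewrite (mixture_integral nu _ _ _ _ (measurable_cos_affine eta theta)); last first.
  by move=> x; exact: cosD1_ge0.
have I0 l j : (0 <= \int[nu]_x (1 + cos (eta * (j%:R * gap R t B l + contraction R n B l * x) + theta))%:E)%E.
  by apply: integral_ge0 => x _; rewrite lee_fin; exact: cosD1_ge0.
have e0 : 0 <= eta `^ (- (beta / 2)) by exact: powR_ge0.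
rewrite [leRHS]EFinD -[X in (_ <= X + _)%E](sum_copy_mass R B t0).
apply: le_trans; last first.
  apply: epsilon_trick => [l|]; first by rewrite lee_fin mulr_ge0.
  by rewrite !mulr_ge0.
apply: lee_nneseries => [l _ _|l _].
  by apply: mule_ge0; [rewrite lee_fin|apply: sume_ge0 => j _; exact: I0].
set d := contraction R n B l; have d0 : 0 < d := contraction_gt0 R B l n0.
have c0 : 0 <= (copy_mass R t B l)%:num :> R by [].
set c := (copy_mass R t B l)%:num in c0 *.
set J := reps t B l.
apply: (@le_trans _ _ (c%:E * \sum_(j < J) (1 + D * (eta * d) `^ (- (beta / 2)))%:E)%E).
  apply: lee_wpmul2l; first by rewrite lee_fin.
  apply: lee_sum => j _.
  rewrite (eq_integral (fun x : measurableTypeR R => (1 + cos (eta * d * x + (eta * (j%:R * gap R t B l) + theta)))%:E)).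
    by apply: hnu; rewrite mulr_gt0.
  by move=> x _; congr (1 + cos _)%:E; rewrite /d; ring.
rewrite sumEFin sumr_const card_ord -EFinM -EFinD lee_fin.
rewrite -[_ *+ J]mulr_natr mulrCA mulrDl mul1r [c * J%:R]mulrC.
set cJ := J%:R * c.
rewrite mulrDl mul1r mulrC lerD2l.
have cJE : cJ <= (2 ^ l)%:R^-1 * (t ^ (B * l))%:R^-1.
  rewrite /cJ mulrC; apply: (le_trans (ler_wpM2r _ (copy_mass_le R B l t0))) => //.
  have pt : (t ^ (B * l))%:R != 0 :> R by rewrite pnatr_eq0 -lt0n expn_gt0 t0.
  rewrite /J /reps mul2n -addnn expnD natrM le_eqVlt; apply/orP; left; apply/eqP.
  by field; rewrite pt pnatr_eq0 -lt0n expn_gt0.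
have dE : d `^ (- (beta / 2)) <= (t ^ (B * l))%:R.
  rewrite /d contraction_powRN.
  by rewrite natrX; apply: lerXn2r; rewrite ?nnegrE ?powR_ge0.
have d00 : 0 <= d `^ (- (beta / 2)) by exact: powR_ge0.
rewrite (powRM _ (ltW eta0) (ltW d0)).
rewrite (_ : cJ * (D * (_ * _)) = (cJ * d `^ (- (beta / 2))) * (D * eta `^ (- (beta / 2)))); last by ring.
rewrite (_ : _ / (2 ^ l.+1)%:R = (2 ^ l)%:R^-1 * (D * eta `^ (- (beta / 2)))); last first.
  by rewrite expnS natrM; field; rewrite pnatr_eq0 -lt0n expn_gt0.
apply: ler_wpM2r; first by rewrite mulr_ge0.
have pt : 0 < (t ^ (B * l))%:R :> R by rewrite ltr0n expn_gt0 t0.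
apply: (@le_trans _ _ ((2 ^ l)%:R^-1 * (t ^ (B * l))%:R^-1 * (t ^ (B * l))%:R)).
  by apply: ler_pM => //; rewrite /cJ mulr_ge0.
by rewrite mulfVK ?gt_eqF.
Qed.

(** The same measure under a name that carries the proof of total mass 1, so that the probability
    structure can be attached to it as an instance. *)
Definition normalized (R : realType) (m : {measure set (measurableTypeR R) -> \bar R})
  & m setT = 1%E : set (measurableTypeR R) -> \bar R := m.

HB.instance Definition _ (R : realType) (m : {measure set (measurableTypeR R) -> \bar R})
  (m1 : m setT = 1%E) := Measure.copy (normalized m1) m.

HB.instance Definition _ (R : realType) (m : {measure set (measurableTypeR R) -> \bar R})
  (m1 : m setT = 1%E) := Measure_isProbability.Build _ _ _ (normalized m1) m1.

(** * Fourier decay of a probability measure *)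

Lemma integrable_cos (R : realType) (mu : probability (measurableTypeR R) R) (eta theta : R) :
  mu.-integrable setT (EFin \o (fun x : R => cos (eta * x + theta))).
Proof.
apply: (@le_integrable _ _ R mu setT measurableT _ (EFin \o cst 1)).
- apply/measurable_EFinP.
  rewrite (_ : (fun x => _) = (fun x : R => (1 + cos (eta * x + theta)) - 1)); last first.
    by apply/funext => x; rewrite addrAC subrr add0r.
  by apply: measurable_funB => //; exact: measurable_cos_affine.
- by move=> x _; rewrite /= lee_fin normr1; exact: cos_max.
- exact: finite_measure_integrable_cst.
Qed.

Lemma Rintegral_prob_cst (R : realType) (mu : probability (measurableTypeR R) R) (r : R) :
  \int[mu]_x r = r.
Proof.
rewrite Rintegral_cst //; set m := (X in fine X).
have -> : m = 1%E := probability_setT mu.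
by rewrite /= mulr1.
Qed.

Lemma Rintegral_cos_le (R : realType) (mu : probability (measurableTypeR R) R) (eta theta e : R) :
  (\int[mu]_x (1 + cos (eta * x + theta))%:E <= (1 + e)%:E)%E ->
  \int[mu]_x cos (eta * x + theta) <= e.
Proof.
move=> H.
have I1 : mu.-integrable setT (EFin \o (cst 1 : R -> R)) by exact: finite_measure_integrable_cst.
have := RintegralD measurableT I1 (integrable_cos mu eta theta).
rewrite Rintegral_prob_cst => E.
have : \int[mu]_x (1 + cos (eta * x + theta)) <= 1 + e.
  rewrite -lee_fin; apply: (le_trans _ H).
  rewrite /Rintegral fineK // ge0_fin_numE; first exact: le_lt_trans H (ltry _).
  by apply: integral_ge0 => x _; rewrite lee_fin; exact: cosD1_ge0.
by rewrite E lerD2l.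
Qed.

Lemma Rintegral_cos_norm_le (R : realType) (mu : probability (measurableTypeR R) R) (eta e : R) :
  (forall theta, (\int[mu]_x (1 + cos (eta * x + theta))%:E <= (1 + e)%:E)%E) ->
  forall theta, `|\int[mu]_x cos (eta * x + theta)| <= e.
Proof.
move=> H theta; rewrite ler_norml; apply/andP; split; last exact: Rintegral_cos_le.
rewrite lerNl; apply: le_trans (Rintegral_cos_le (H (theta + pi))).
rewrite -mulN1r -RintegralZl //; last exact: integrable_cos.
rewrite le_eqVlt; apply/orP; left; apply/eqP; apply: eq_Rintegral => x _.
by rewrite addrA (@cosDpi R) mulN1r.
Qed.

Lemma normc_le (R : realType) (a b : R) : normc (a +i* b)%C <= `|a| + `|b|.
Proof.
rewrite /= -[leRHS]ger0_norm ?addr_ge0 // -sqrtr_sqr ler_sqrt ?sqr_ge0 //.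
rewrite sqrrD !real_normK ?num_real // addrAC lerDl.
by rewrite mulrn_wge0 // mulr_ge0.
Qed.

Lemma fourier_le (R : realType) (mu : probability (measurableTypeR R) R) (xi e : R) :
  (forall theta, `|\int[mu]_x cos (2 * pi * `|xi| * x + theta)| <= e) ->
  normc (fourier mu xi) <= 2 * e.
Proof.
move=> H; apply: (le_trans (normc_le _ _)); rewrite [leRHS]mulr_natl mulr2n.
have [xi0|xi0] := leP 0 xi; rewrite ?(ger0_norm xi0) ?(ltr0_norm xi0) in H; apply: lerD.
- rewrite (@eq_Rintegral _ _ _ _ _ (fun x : measurableTypeR R => cos (2 * pi * xi * x + 0))) => [|x _]; first exact: H.
  by rewrite /= cosN; congr cos; ring.
- rewrite (@eq_Rintegral _ _ _ _ _ (fun x : measurableTypeR R => cos (2 * pi * xi * x + pi / 2))) => [|x _]; first exact: H.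
  by rewrite /= cosDpihalf sinN; congr (- sin _); ring.
- rewrite (@eq_Rintegral _ _ _ _ _ (fun x : measurableTypeR R => cos (2 * pi * (- xi) * x + 0))) => [|x _]; first exact: H.
  by rewrite /=; congr cos; ring.
- rewrite (@eq_Rintegral _ _ _ _ _ (fun x : measurableTypeR R => cos (2 * pi * (- xi) * x - pi / 2))) => [|x _]; first exact: H.
  by rewrite /= cosBpihalf; congr sin; ring.
Qed.

Lemma fourier_decay (R : realType) (mu : probability (measurableTypeR R) R) (g D : R) :
  0 <= g <= 1 -> 0 <= D ->
  (forall eta theta : R, 0 < eta ->
    (\int[mu]_x (1 + cos (eta * x + theta))%:E <= (1 + D * eta `^ (- g))%:E)%E) ->
  forall xi : R, normc (fourier mu xi) <= (2 * D + 4) * (1 + `|xi|) `^ (- g).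
Proof.
move=> /andP[g0 g1] D0 H xi.
have pi2 := pi_ge2 R.
have xi0 : 0 <= `|xi| := normr_ge0 xi.
have p1 : 0 < 1 + `|xi| by lra.
have pg : 0 < (1 + `|xi|) `^ (- g) by exact: powR_gt0.
have [x1|x1] := leP 1 `|xi|.
  have eta0 : 0 < 2 * pi * `|xi| by rewrite mulr_gt0 // ?mulr_gt0; lra.
  have := fourier_le (Rintegral_cos_norm_le (fun theta => H _ theta eta0)).
  move/le_trans; apply.
  have : (2 * pi * `|xi|) `^ (- g) <= (1 + `|xi|) `^ (- g).
    rewrite !powRN lef_pV2 ?posrE ?powR_gt0 //.
    by apply: ge0_ler_powR; rewrite ?nnegrE; [lra|lra|exact: ltW|nra].
  nra.
(* For |xi| < 1 the trivial bound 2 of the transform suffices: (1 + |xi|)^(-g) >= 1/2 because g <=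
   1, which accounts for the term 4 of the constant. *)
have hle theta : `|\int[mu]_x cos (2 * pi * `|xi| * x + theta)| <= 1.
  apply: (le_trans (le_normr_Rintegral measurableT (integrable_cos _ _ _))).
  apply: (@le_trans _ _ (\int[mu]_x 1)); last first.
    by rewrite Rintegral_prob_cst.
  apply: le_Rintegral => //.
  - exact: (integrable_norm (integrable_cos mu _ theta)).
  - exact: finite_measure_integrable_cst.
  - by move=> x _; exact: cos_max.
apply: (le_trans (fourier_le hle)).
have : 1 / 2 <= (1 + `|xi|) `^ (- g).
  rewrite powRN div1r lef_pV2 ?posrE ?powR_gt0 //.
  apply: (@le_trans _ _ ((1 + `|xi|) `^ 1)); first by apply: ler_powR => //; lra.
  by rewrite powRr1; lra.
nra.
Qed.

(** * Hausdorff dimension *)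

Lemma diameter_ge0 (R : realType) (A : set R) (x : R) : A x -> (0 <= diameter A)%E.
Proof.
move=> Ax; apply: ereal_sup_ubound; exists x => //; exists x => //.
by rewrite subrr normr0.
Qed.

Lemma diameter_pow_ge0 (R : realType) (s : R) (A : set R) : (0 <= diameter_pow s A)%E.
Proof. by rewrite /diameter_pow; case: ifP => // _; exact: poweR_ge0. Qed.

Lemma diameter_segment_le (R : realType) (a l : R) : 
  (diameter (`[a, (a + l)%R]%classic : set R) <= l%:E)%E.
Proof.
apply: ge_ereal_sup => _ [x /= xI [y /= yI <-]].
move: xI yI; rewrite !in_itv /= => /andP[x1 x2] /andP[y1 y2].
by rewrite lee_fin ler_norml; apply/andP; split; lra.
Qed.

Lemma diameter_pow_segment_le (R : realType) (s a l : R) : 0 <= s ->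
  (diameter_pow s (`[a, (a + l)%R]%classic : set R) <= (l `^ s)%:E)%E.
Proof.
move=> s0; rewrite /diameter_pow; case: eqP => [_|/eqP/set0P[x xI]].
  by rewrite lee_fin powR_ge0.
have d0 := diameter_ge0 xI; have dl := diameter_segment_le a l.
rewrite -poweR_EFin; apply: gt0_ler_poweR => //.
  by rewrite in_itv /= d0 leey.
by rewrite in_itv /= (le_trans d0 dl) leey.
Qed.

Lemma hausdorff_measure_eq0 (R : realType) (s : R) (A : set R) : 0 < s ->
  (forall e : R, 0 < e -> exists I : seq (R * R),
     [/\ A `<=` \big[setU/set0]_(i <- I) `[i.1, i.1 + i.2]%classic,
         (forall i, i \in I -> 0 <= i.2) &
         \sum_(i <- I) i.2 `^ s <= e]) ->
  hausdorff_measure s A = 0%E.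
Proof.
move=> s0 H.
have pre0 d : 0 < d -> hausdorff_premeasure s d A = 0%E.
  move=> d0; apply/eqP; rewrite eq_le; apply/andP; split; last first.
    apply: le_ereal_inf_tmp => _ [U _ <-].
    by apply: nneseries_ge0 => i _ _; exact: diameter_pow_ge0.
  apply/lee_addgt0Pr => e e0; rewrite add0e.
  (* A sum of at most d^s bounds every single term l^s, hence forces every length to be at most d;
     no separate mesh condition is required of the cover. *)
  have [|I [AI I0 Ie]] := H (Num.min e (d `^ s)).
    by rewrite lt_min e0 powR_gt0.
  pose U i : set R := if (i < size I)%N then
    `[(nth (0, 0) I i).1, (nth (0, 0) I i).1 + (nth (0, 0) I i).2]%classic else set0.
  apply: (@le_trans _ _ (\sum_(0 <= i <oo) diameter_pow s (U i))%E).
    apply: ereal_inf_lbound; exists U => //; split.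
      pose F k : set R := `[(nth (0, 0) I k).1, (nth (0, 0) I k).1 + (nth (0, 0) I k).2]%classic.
      move=> x /AI; rewrite (big_nth (0, 0)) big_mkord -(bigcup_mkord (size I) F).
      move=> -[k /= kI xk].
      by exists k => //; rewrite /U kI.
    move=> i; rewrite /U; case: ifP => iI; last first.
      by apply: ge_ereal_sup => _ [x []].
    apply: (le_trans (diameter_segment_le _ _)); rewrite lee_fin.
    set l := (nth _ _ _).2; have l0 : 0 <= l by apply: I0; exact: mem_nth.
    have : l `^ s <= d `^ s.
      apply: le_trans; last by apply: le_trans Ie _; rewrite ge_min lexx orbT.
      rewrite (big_nth (0, 0)) big_mkord (bigD1 (Ordinal iI)) //= lerDl.
      by apply: sumr_ge0 => j _; exact: powR_ge0.
    by rewrite leNgt => /negP h; rewrite leNgt; apply/negP => dl; apply: h;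
       apply: gt0_ltr_powR; rewrite ?nnegrE // ltW.
  rewrite (nneseries_split 0 (size I)); last by move=> k _; exact: diameter_pow_ge0.
  rewrite [X in (_ + X)%E]eseries0 => [|k kI _]; last first.
    by rewrite /U ltnNge -[X in (X <= _)%N]add0n kI /= /diameter_pow eqxx.
  rewrite adde0 add0n big_mkord.
  apply: (@le_trans _ _ (\sum_(i <- I) i.2 `^ s)%:E); last first.
    by rewrite lee_fin (le_trans Ie) // ge_min lexx.
  rewrite (big_nth (0, 0)) big_mkord -sumEFin; apply: lee_sum => i _.
  by rewrite /U ltn_ord; apply: diameter_pow_segment_le; exact: ltW.
apply/eqP; rewrite eq_le; apply/andP; split.
  by apply: ge_ereal_sup => _ [d /= d0 <-]; rewrite pre0.
by apply: ereal_sup_ubound; exists 1 => //=; rewrite pre0.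
Qed.

(** The mass distribution principle: a nonempty set of diameter d <= 1 lies in the segment of radius
    d about any of its points, whose mass is at most C d^alpha <= C1 d^s if s < alpha. Every cover
    then has sum at least 1 / C1; taking C1 = C + 1 keeps it invertible. *)
Lemma mass_distribution (R : realType) (mu : probability (measurableTypeR R) R)
    (E : set (measurableTypeR R)) (alpha C s : R) :
  measurable E -> mu E = 1%E -> 0 <= C -> 0 < alpha ->
  (forall x r : R, 0 < r -> (mu `[(x - r)%R, (x + r)%R]%classic <= (C * r `^ alpha)%:E)%E) ->
  0 <= s -> hausdorff_measure s E = 0%E -> alpha <= s.
Proof.
move=> mE muE C0 a0 hmu s0 hs; rewrite leNgt; apply/negP => sa.
pose C1 := C + 1; have C10 : 0 < C1 by rewrite /C1; lra.
have pre : (hausdorff_premeasure s 1 E <= 0)%E.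
  by rewrite -hs; apply: ereal_sup_ubound; exists 1 => //=.
suff : (C1^-1%:E <= hausdorff_premeasure s 1 E)%E.
  by move=> /le_trans /(_ pre); rewrite lee_fin leNgt invr_gt0 C10.
apply: le_ereal_inf_tmp => _ [U [EU dU] <-].
have hull i : exists V : set (measurableTypeR R), [/\ measurable V, U i `<=` V &
    (mu V <= C1%:E * diameter_pow s (U i))%E].
  have [->|/set0P[x Ux]] := eqVneq (U i) set0.
    by exists set0; split => //; rewrite measure0 mule_ge0 // ?diameter_pow_ge0 // lee_fin ltW.
  have d0 := diameter_ge0 Ux; have d1 := dU i.
  have dfin : diameter (U i) \is a fin_num.
    by rewrite ge0_fin_numE // (le_lt_trans d1) // ltry.
  pose d := fine (diameter (U i)).
  have dE : diameter (U i) = d%:E by rewrite fineK.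
  rewrite dE !lee_fin in d0 d1.
  exists `[x - d, x + d]%classic; split.
  - exact: measurable_itv.
  - move=> y Uy /=; rewrite in_itv /= .
    have : (`|x - y|%:E <= diameter (U i))%E.
      by apply: ereal_sup_ubound; exists x => //; exists y.
    by rewrite dE lee_fin ler_norml => /andP[h1 h2]; apply/andP; split; lra.
  - rewrite /diameter_pow ifF; last by apply/negbTE/set0P; exists x.
    rewrite dE poweR_EFin -EFinM.
    have [dp|dn] := ltP 0 d.
      apply: (le_trans (hmu x d dp)); rewrite lee_fin; apply: ler_pM => //.
      - exact: powR_ge0.
      - by rewrite /C1; lra.
      - by apply: ger_powR => //; [apply/andP|exact: ltW].
    (* A one-point set: the Frostman bound speaks of r > 0 only, so the point is enclosed in
       segments with C r^alpha <= e for arbitrary e > 0. *)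
    have d00 : d = 0 by lra.
    apply: (@le_trans _ _ 0%E); last by rewrite lee_fin mulr_ge0 ?powR_ge0 // ltW.
    apply/lee_addgt0Pr => e e0; rewrite add0e.
    pose r := (e / C1) `^ alpha^-1.
    have eC : 0 < e / C1 by rewrite divr_gt0.
    have r0 : 0 < r by rewrite powR_gt0.
    apply: (@le_trans _ _ (mu `[(x - r)%R, (x + r)%R]%classic)).
      apply: le_measure; rewrite ?inE; [exact: measurable_itv|exact: measurable_itv|].
      by move=> y /=; rewrite !in_itv /= d00 => /andP[h1 h2]; apply/andP; split; lra.
    apply: (le_trans (hmu x r r0)); rewrite lee_fin.
    rewrite /r -powRrM mulVf ?gt_eqF // (powRr1 (ltW eC)).
    by rewrite mulrCA ger_pMr // ler_pdivrMr // mul1r /C1; lra.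
have /choice[V HV] := hull.
have mV i : measurable (V i) by have [] := HV i.
have sub : E `<=` \bigcup_i V i.
  by move=> x /EU[i _ Uix]; exists i => //; have [_ UV _] := HV i; exact: UV.
have h1 : (mu E <= \sum_(i <oo) mu (V i))%E by exact: measure_sigma_subadditive.
rewrite muE in h1.
have h2 : (\sum_(i <oo) mu (V i) <= C1%:E * \sum_(0 <= i <oo) diameter_pow s (U i))%E.
  rewrite -nneseriesZl; last by move=> i _; exact: diameter_pow_ge0.
  apply: lee_nneseries => [i _ _|i _]; first exact: measure_ge0.
  by have [] := HV i.
have h3 := le_trans h1 h2.
by rewrite -(@lee_pmul2l _ C1%:E) // ?lte_fin // -EFinM mulfV ?gt_eqF.
Qed.

Lemma hausdorff_dim_eq (R : realType) (E : set R) (alpha : R) : 0 <= alpha ->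
  (forall s, alpha < s -> hausdorff_measure s E = 0%E) ->
  (forall s, 0 <= s -> hausdorff_measure s E = 0%E -> alpha <= s) ->
  hausdorff_dim E = alpha%:E.
Proof.
move=> a0 up low; apply/eqP; rewrite eq_le; apply/andP; split; last first.
  by apply: le_ereal_inf_tmp => _ [s [s0 hs] <-]; rewrite lee_fin; exact: low.
apply/lee_addgt0Pr => e e0; rewrite -EFinD; apply: ereal_inf_lbound.
by exists (alpha + e) => //; split; [lra|apply: up; lra].
Qed.

(** * Lower bounds for the norms *)

(** Comparing the suprema over simple functions avoids measurability questions; it is applied to a
    power of a Fourier transform as a function of xi. *)
Lemma ge0_le_integral_total d (T : measurableType d) (R : realType)
    (mu : {measure set T -> \bar R}) (f g : T -> \bar R) :
  (forall x, 0 <= f x)%E -> (forall x, f x <= g x)%E ->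
  (\int[mu]_x f x <= \int[mu]_x g x)%E.
Proof.
move=> f0 fg; have g0 x : (0 <= g x)%E := le_trans (f0 x) (fg x).
rewrite !ge0_integralTE //; apply: ge_ereal_sup => _ [h hf <-].
by apply: ereal_sup_ubound; exists h => // x; exact: le_trans (hf x) (fg x).
Qed.

Lemma Lnorm_ge_on_set (R : realType) (p c g : R) (F : R -> R) (G : set R) :
  0 < p -> 0 <= c -> 0 <= g -> measurable (G : set (measurableTypeR R)) ->
  (g%:E <= @lebesgue_measure R G)%E -> (forall xi, G xi -> c <= F xi) ->
  ((c * g `^ p^-1)%:E <= 'N[@lebesgue_measure R]_(p%:E)[(fun xi => (F xi)%:E)])%E.
Proof.
move=> p0 c0 g0 mG gG cF; rewrite Lnorm.unlock.
have pV0 : 0 <= p^-1 by rewrite invr_ge0 ltW.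
have -> : (c * g `^ p^-1)%:E = poweR (c `^ p * g)%:E p^-1.
  by rewrite poweR_EFin powRM ?powR_ge0 // -powRrM mulfV ?gt_eqF // powRr1.
apply: gt0_ler_poweR => //.
- by rewrite in_itv /= lee_fin mulr_ge0 ?powR_ge0 // leey.
- by rewrite in_itv /= leey andbT; apply: integral_ge0 => x _; rewrite lee_fin powR_ge0.
have mI : measurable_fun [set: measurableTypeR R] (fun x : measurableTypeR R => (\1_G x : R)%:E).
  by apply/measurable_EFinP; exact: measurable_indic.
apply: (@le_trans _ _ (\int[@lebesgue_measure R]_x ((c `^ p)%:E * (\1_G x : R)%:E))%E).
  rewrite ge0_integralZl_EFin ?powR_ge0 //.
  rewrite integral_indic // setIT EFinM.
  by apply: lee_wpmul2l => //; rewrite lee_fin powR_ge0.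
apply: ge0_le_integral_total => x.
  by rewrite -EFinM lee_fin mulr_ge0 // powR_ge0.
rewrite abse_EFin poweR_EFin -EFinM lee_fin indicE.
have [xG|_] := boolP (x \in G); last by rewrite mulr0 powR_ge0.
rewrite mulr1; have h := cF x (set_mem xG).
apply: ge0_ler_powR; rewrite ?nnegrE //; first exact: ltW.
exact: le_trans h (ler_norm _).
Qed.

Lemma Lnorm2_indic (R : realType) (mu : probability (measurableTypeR R) R) (A : set R) :
  measurable (A : set (measurableTypeR R)) ->
  ('N[mu]_(2%:E)[EFin \o \1_A] = (Num.sqrt (fine (mu A)))%:E)%E.
Proof.
move=> mA; rewrite Lnorm.unlock.
rewrite (eq_integral (fun x : measurableTypeR R => (\1_A x)%:E)) => [|x _]; last first.
  rewrite /= indicE; case: (_ \in _); rewrite ?normr1 ?normr0 ?powR1 // powR0 //.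
rewrite integral_indic // setIT -powR12_sqrt; last first.
  by apply: fine_ge0; exact: measure_ge0.
by rewrite -poweR_EFin fineK // fin_num_measure.
Qed.

Lemma fourier_density_indic_ge (R : realType) (mu : probability (measurableTypeR R) R)
    (A : set R) (xi : R) :
  measurable (A : set (measurableTypeR R)) ->
  (forall x, A x -> 1 / 2 <= cos (2 * pi * x * xi)) ->
  1 / 2 * fine (mu A) <= normc (fourier_density mu \1_A xi).
Proof.
move=> mA hA.
have mI : measurable_fun [set: measurableTypeR R] (\1_A : R -> R) by exact: measurable_indic.
have int01 (f : R -> R) : measurable_fun [set: measurableTypeR R] f -> (forall x, `|f x| <= 1) ->
    mu.-integrable setT (EFin \o f).
  move=> mf f1; apply: (@le_integrable _ _ R mu setT measurableT _ (EFin \o cst 1)).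
  - exact/measurable_EFinP.
  - by move=> x _; rewrite /= lee_fin normr1.
  - exact: finite_measure_integrable_cst.
have iI : mu.-integrable setT (EFin \o (\1_A : R -> R)).
  by apply: int01 => // x; rewrite indicE; case: (_ \in _); rewrite ?normr1 ?normr0.
apply: (@le_trans _ _ (\int[mu]_x (\1_A x * cos (2 * pi * xi * x + 0)))).
  have -> : 1 / 2 * fine (mu A) = \int[mu]_x (1 / 2 * \1_A x).
    by rewrite RintegralZl // /Rintegral integral_indic // setIT.
  apply: le_Rintegral => //.
  - apply: int01 => [|x].
      by apply: measurable_funM => //; exact: measurable_cst.
    rewrite indicE; case: (_ \in _); rewrite ?mulr0 ?normr0 ?mulr1 //.
    by rewrite ger0_norm; lra.
  - apply: int01 => [|x].
      apply: measurable_funM => //.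
      rewrite (_ : (fun x => _) = (fun x : R => (1 + cos (2 * pi * xi * x + 0)) - 1)); last first.
        by apply/funext => x; rewrite addrAC subrr add0r.
      by apply: measurable_funB => //; exact: measurable_cos_affine.
    rewrite indicE; case: (_ \in _); rewrite ?mul0r ?normr0 ?mul1r //.
    exact: cos_max.
  - move=> x _; rewrite indicE; have [xA|_] := boolP (x \in A); last by rewrite mulr0 mul0r.
    rewrite mulr1 [1 * cos _]mul1r (_ : _ + 0 = 2 * pi * x * xi); last by ring.
    exact: hA (set_mem xA).
set I := Rintegral _ _ _.
have -> : I = complex.Re (fourier_density mu \1_A xi).
  apply: eq_Rintegral => x _; rewrite /= cosN mul0r subr0; congr (_ * cos _); ring.
case: (fourier_density mu _ xi) => a b /=.
rewrite (le_trans (ler_norm a)) // -sqrtr_sqr ler_sqrt ?addr_ge0 ?sqr_ge0 //.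
by rewrite lerDl sqr_ge0.
Qed.

(** The numerator is at least mu(A) g^(1/p) / 2 and the denominator is sqrt (mu A), so the resulting
    bound increases with mu(A) and a lower bound m of the mass can be inserted. *)
Lemma norm_ratio_ge (R : realType) (mu : probability (measurableTypeR R) R)
    (A G : set R) (m g p : R) :
  measurable (A : set (measurableTypeR R)) -> measurable (G : set (measurableTypeR R)) ->
  0 < p -> 0 < m -> 0 <= g -> (m%:E <= mu A)%E -> (g%:E <= @lebesgue_measure R G)%E ->
  (forall xi x, G xi -> A x -> 1 / 2 <= cos (2 * pi * x * xi)) ->
  ((1 / 2 * Num.sqrt m * g `^ p^-1)%:E <=
    'N[@lebesgue_measure R]_(p%:E)[(fun xi : R => (normc (fourier_density mu \1_A xi))%:E)]
    / 'N[mu]_(2%:E)[EFin \o \1_A])%E.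
Proof.
move=> mA mG p0 m0 g0 mmu gG hc.
have [r rE] : exists r, mu A = r%:E by exists (fine (mu A)); rewrite fineK // fin_num_measure.
have rm : m <= r by rewrite rE lee_fin in mmu.
have r0 : 0 < r := lt_le_trans m0 rm.
have H : ((1 / 2 * r * g `^ p^-1)%:E <=
    'N[@lebesgue_measure R]_(p%:E)[(fun xi : R => (normc (fourier_density mu \1_A xi))%:E)])%E.
  apply: (Lnorm_ge_on_set p0 _ g0 mG gG); first by rewrite mulr_ge0 // ltW.
  move=> xi xiG.
  have := @fourier_density_indic_ge R mu A xi mA (fun x Ax => hc xi x xiG Ax).
  by rewrite rE.
have sr : 0 < Num.sqrt r by rewrite sqrtr_gt0.
rewrite Lnorm2_indic // rE [fine _]/= inver gt_eqF //.
apply: (@le_trans _ _ ((1 / 2 * r * g `^ p^-1)%:E * ((Num.sqrt r)^-1)%:E)%E); last first.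
  by apply: lee_wpmul2r => //; rewrite lee_fin invr_ge0 sqrtr_ge0.
rewrite -EFinM lee_fin.
have rr : r = Num.sqrt r * Num.sqrt r by rewrite -expr2 sqr_sqrtr // ltW.
have -> : 1 / 2 * r * g `^ p^-1 / Num.sqrt r = 1 / 2 * Num.sqrt r * g `^ p^-1.
  by rewrite {1}rr; field; rewrite gt_eqF.
apply: ler_wpM2r; first exact: powR_ge0.
by apply: ler_wpM2l => //; rewrite ler_sqrt // ltW.
Qed.

(** * Progressions, their duals and the carrier set *)

Definition progression (R : realType) (J : nat) (b d : R) : set R :=
  \big[setU/set0]_(j < J) `[j%:R * b, j%:R * b + d]%classic.

Definition dual_set (R : realType) (K : nat) (b s : R) : set R :=
  \big[setU/set0]_(k < K) `[k%:R / b, (k%:R + s) / b]%classic.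

Lemma bigsetU_ordP (R : realType) (J : nat) (F : nat -> set R) (x : R) :
  (\big[setU/set0]_(j < J) F j) x <-> exists2 j, (j < J)%N & F j x.
Proof.
rewrite -(bigcup_mkord J F); split; first by move=> [j /= jJ Fx]; exists j.
by move=> [j jJ Fx]; exists j.
Qed.

(** Write x = j b + v and xi = (k + u) / b. Then x xi = j k + j u + v xi, where j k is an integer, j
    u <= J s <= 1/32 and v xi <= K d / b <= 1/32. The phase is at most 2 pi / 16 <= 1/2 modulo 2 pi,
    and the cosine is 1-Lipschitz. *)
Lemma cos_progression_ge (R : realType) (J K : nat) (b d s x xi : R) :
  0 < b -> 0 <= d -> 0 <= s <= 1 -> J%:R * s <= 1 / 32 -> K%:R * d <= b / 32 ->
  progression J b d x -> dual_set K b s xi -> 1 / 2 <= cos (2 * pi * x * xi).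
Proof.
move=> b0 d0 /andP[s0 s1] Js Kd /(@bigsetU_ordP R J (fun j => `[j%:R * b, j%:R * b + d]%classic)) [j jJ xj].
move=> /(@bigsetU_ordP R K (fun k => `[k%:R / b, (k%:R + s) / b]%classic)) [k kK xik].
move: xj xik; rewrite /= !in_itv /= => /andP[x1 x2].
rewrite ler_pdivrMr // ler_pdivlMr // => /andP[xi1 xi2].
pose u := xi * b - k%:R; pose v := x - j%:R * b.
have u0 : 0 <= u by rewrite /u; lra.
have us : u <= s by rewrite /u; lra.
have v0 : 0 <= v by rewrite /v; lra.
have vd : v <= d by rewrite /v; lra.
have kK' : k%:R + 1 <= K%:R :> R by rewrite natr1 ler_nat.
have jJ' : j%:R <= J%:R :> R by rewrite ler_nat ltnW.
have xi0 : 0 <= xi by rewrite -(pmulr_lge0 _ b0) (le_trans _ xi1).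
have xiK : xi * b <= K%:R by lra.
have ju0 : 0 <= j%:R * u by rewrite mulr_ge0.
have ju : j%:R * u <= 1 / 32 by apply: le_trans Js; apply: ler_pM.
have vxi0 : 0 <= v * xi by rewrite mulr_ge0.
have vxi : v * xi <= 1 / 32.
  apply: (@le_trans _ _ (d * xi)); first exact: ler_wpM2r.
  rewrite -(ler_pM2r b0) -mulrA; apply: (@le_trans _ _ (d * K%:R)); first exact: ler_wpM2l.
  by rewrite mulrC; lra.
have -> : cos (2 * pi * x * xi) = cos (2 * pi * (j%:R * u + v * xi)).
  rewrite -[RHS](cosD_2piMn _ (j * k)); congr cos.
  by rewrite natrM /u /v; ring.
set y := 2 * pi * _.
have pi0 := pi_ge0 R; have pi4 := pihalf_lt2 R.
have y0 : 0 <= y by rewrite !mulr_ge0 // addr_ge0.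
have y1 : y <= 1 / 2 by rewrite /y; nra.
have := cos_lipschitz 0 y; rewrite cos0 sub0r normrN (ger0_norm y0) ler_norml; lra.
Qed.

Lemma dual_set_measure (R : realType) (K : nat) (b s : R) : 0 < b -> 0 <= s < 1 ->
  @lebesgue_measure R (dual_set K b s) = (K%:R * (s / b))%:E.
Proof.
move=> b0 /andP[s0 s1]; pose F (k : nat) : set R := `[k%:R / b, (k%:R + s) / b]%classic.
have tF : trivIset setT F.
  apply: ltn_trivIset => m k km; apply/seteqP; split => // x [].
  rewrite /F /= !in_itv /= !ler_pdivrMr // !ler_pdivlMr // => /andP[h1 h2] /andP[h3 h4].
  have : k%:R + 1 <= m%:R :> R by rewrite natr1 ler_nat.
  lra.
have mF k : measurable (F k : set (measurableTypeR R)) by exact: measurable_itv.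
have lF k : @lebesgue_measure R (F k) = (s / b)%:E.
  rewrite /F lebesgue_measure_itv /= lte_fin ltr_pM2r ?invr_gt0 // ltrDl.
  case: ltP => s00; first by rewrite -EFinB; congr (_%:E); ring.
  by have -> : s = 0; [lra|rewrite mul0r].
have -> : dual_set K b s = \big[setU/set0]_(k < K) F k by [].
rewrite (measure_semi_additive_ord_I lebesgue_measure) //; last first.
- exact: bigsetU_measurable.
- exact: sub_trivIset tF.
rewrite (eq_bigr (fun=> (s / b)%:E)) => [|k _].
  by rewrite sumEFin sumr_const card_ord mulr_natl.
exact: lF.
Qed.

Definition cover_index (J : nat -> nat) (m : nat) : seq (nat * nat) :=
  [seq (l, j) | l <- iota 0 m, j <- iota 0 (J l)].

Definition cover_list (R : realType) (J : nat -> nat) (b d : nat -> R)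
    (n t : nat) (a : nat -> nat -> R) (m N : nat) : seq (R * R) :=
  (0, (2 ^ m)%:R^-1) :: [seq (lj.2%:R * b lj.1 + d lj.1 * a N i, d lj.1 / (n ^ N)%:R)
    | lj <- cover_index J m, i <- iota 0 (t ^ N)].

Definition cover_set (R : realType) (I : seq (R * R)) : set R :=
  \big[setU/set0]_(i <- I) `[i.1, i.1 + i.2]%classic.

(* Finite covers of the pieces l < m at level N, with [0, 2^-m] absorbing the others:
   closed by construction. *)
Definition carrier (R : realType) (J : nat -> nat) (b d : nat -> R)
    (n t : nat) (a : nat -> nat -> R) : set R :=
  \bigcap_m \bigcap_N cover_set (cover_list J b d n t a m N).

Lemma cover_setP (R : realType) (I : seq (R * R)) (x : R) :
  cover_set I x <-> exists2 i, i \in I & i.1 <= x <= i.1 + i.2.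
Proof.
rewrite /cover_set -bigcup_seq; split.
  by move=> [i /= iI]; rewrite in_itv /= => xi; exists i.
by move=> [i iI xi]; exists i => //=; rewrite in_itv.
Qed.

Lemma cover_set_closed (R : realType) (I : seq (R * R)) : closed (cover_set I).
Proof. by apply: closed_bigsetU => i _; exact: interval_closed. Qed.

Lemma cover_set_measurable (R : realType) (I : seq (R * R)) :
  measurable (cover_set I : set (measurableTypeR R)).
Proof. by apply: bigsetU_measurable => i _; exact: measurable_itv. Qed.

Lemma carrier_closed (R : realType) (J : nat -> nat) (b d : nat -> R)
    (n t : nat) (a : nat -> nat -> R) : closed (carrier J b d n t a).
Proof.
by apply: closed_bigI => m _; apply: closed_bigI => N _; exact: cover_set_closed.
Qed.

Lemma carrier_measurable (R : realType) (J : nat -> nat) (b d : nat -> R)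
    (n t : nat) (a : nat -> nat -> R) :
  measurable (carrier J b d n t a : set (measurableTypeR R)).
Proof.
apply: bigcap_measurable => // m _; apply: bigcap_measurable => // N _.
exact: cover_set_measurable.
Qed.

Lemma carrier_sub01 (R : realType) (J : nat -> nat) (b d : nat -> R)
    (n t : nat) (a : nat -> nat -> R) : carrier J b d n t a `<=` `[0, 1].
Proof.
move=> x hx; have [k] := (cover_setP _ _).1 (hx 0%N Logic.I 0%N Logic.I).
rewrite inE => /eqP -> /=; rewrite in_itv /= expn0 invr1 add0r; by [].
Qed.

Lemma exprn_small (R : realType) (x e : R) : 0 <= x < 1 -> 0 < e -> exists N, x ^+ N <= e.
Proof.
move=> /andP[x0 x1] e0; have xn : `|x| < 1 by rewrite ger0_norm.
have /cvgr0Pnorm_le /(_ e e0)[N _ HN] := cvg_expr xn.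
exists N; have := HN N (leqnn N); rewrite ger0_norm ?exprn_ge0 //.
Qed.

(** First m makes the contribution 2^(-m s) of [0, 2^(-m)] at most e / 2. Only finitely many copies
    are then left, and N is chosen according to their number: each contributes at most t^N n^(-N s)
    = n^((alpha - s) N), as its scale is at most 1. *)
Lemma carrier_hausdorff_eq0 (R : realType) (J : nat -> nat) (b d : nat -> R)
    (n t : nat) (a : nat -> nat -> R) (alpha s : R) :
  (1 < n)%N -> n%:R `^ alpha = t%:R -> 0 <= alpha -> (forall l, 0 <= d l <= 1) -> alpha < s ->
  hausdorff_measure s (carrier J b d n t a) = 0%E.
Proof.
move=> n1 ntE a0 d01 sa; have s0 : 0 < s by lra.
apply: hausdorff_measure_eq0 => // e e0.
have [|m Hm] := @exprn_small R (2 `^ (- s)) (e / 2) _ ltac:(by rewrite divr_gt0).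
  by rewrite powR_ge0 -[ltRHS](powRr0 2) lt1_ltr_powR ?ltr1n //; lra.
pose P := cover_index J m.
have [||N HN] := @exprn_small R (n%:R `^ (alpha - s)) (e / 2 / (size P).+1%:R).
- by rewrite powR_ge0 -[ltRHS](powRr0 n%:R) lt1_ltr_powR ?ltr1n //; lra.
- by rewrite !divr_gt0.
exists (cover_list J b d n t a m N); split.
- by move=> x /(_ m Logic.I N Logic.I).
- move=> i; rewrite inE => /orP[/eqP -> /=|]; first by rewrite invr_ge0.
  by move=> /allpairsP[[lj k] [_ _ ->]] /=; have /andP[? _] := d01 lj.1; rewrite divr_ge0.
rewrite big_cons /= big_allpairs_dep /=.
have -> : e = e / 2 + e / 2 by lra.
apply: lerD.
  apply: le_trans Hm; rewrite le_eqVlt; apply/orP; left; apply/eqP.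
  rewrite natrX -(powR_invn m (ler0n R 2)) -powRrM -(powR_mulrn m (powR_ge0 _ _)) -powRrM.
  by congr (_ `^ _); ring.
apply: (@le_trans _ _ (\sum_(lj <- P) (t ^ N)%:R * ((n ^ N)%:R^-1 `^ s))).
  apply: ler_sum => lj _.
  have -> : (t ^ N)%:R * ((n ^ N)%:R^-1 `^ s) = \sum_(i <- iota 0 (t ^ N)) ((n ^ N)%:R^-1 `^ s) :> R.
    by rewrite big_const_seq count_predT size_iota iter_addr_0 mulr_natl.
  apply: ler_sum => i _; have /andP[dl0 dl1] := d01 lj.1.
  apply: ge0_ler_powR; rewrite ?nnegrE ?divr_ge0 ?invr_ge0 //; first exact: ltW.
  by rewrite ler_piMl // invr_ge0.
rewrite big_const_seq count_predT iter_addr_0 -[_ *+ _]mulr_natl.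
have -> : (t ^ N)%:R * ((n ^ N)%:R^-1 `^ s) = (n%:R `^ (alpha - s)) ^+ N :> R.
  rewrite [X in X * _]natrX -ntE [in X in _ * X]natrX -(powR_invn N (ler0n R n)) -powRrM.
  rewrite -!(powR_mulrn N (powR_ge0 _ _)) -!powRrM -powRD; last first.
    by rewrite pnatr_eq0 -lt0n (ltnW n1) implybT.
  by congr (_ `^ _); ring.
have sP : 0 < (size P).+1%:R :> R by [].
apply: (@le_trans _ _ ((size P).+1%:R * (n%:R `^ (alpha - s)) ^+ N)).
  by apply: ler_wpM2r; rewrite ?exprn_ge0 ?powR_ge0 // ler_nat.
by rewrite mulrC -ler_pdivlMr.
Qed.

(** * Masses of the carrier set and of the progressions *)

Lemma probability_eq1_sub (R : realType) (nu : probability (measurableTypeR R) R)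
    (A B : set (measurableTypeR R)) :
  measurable A -> measurable B -> A `<=` B -> nu A = 1%E -> nu B = 1%E.
Proof.
move=> mA mB AB nuA; apply/eqP; rewrite eq_le probability_le1 //= -nuA.
by apply: le_measure; rewrite ?inE.
Qed.

Lemma probability_bigcap (R : realType) (mu : probability (measurableTypeR R) R)
    (F : nat -> set (measurableTypeR R)) :
  (forall k, measurable (F k)) -> (forall k, mu (F k) = 1%E) -> mu (\bigcap_k F k) = 1%E.
Proof.
move=> mF F1; have mI : measurable (\bigcap_k F k) by exact: bigcap_measurable.
have C0 k : mu (~` F k) = 0%E by rewrite probability_setC // F1 subee.
have h : (mu (~` \bigcap_k F k) <= \sum_(k <oo) mu (~` F k))%E.
  apply: measure_sigma_subadditive; [by move=> k; exact: measurableC|exact: measurableC|].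
  by rewrite setC_bigcap.
rewrite eseries0 in h; last by move=> k _ _; exact: C0.
have CI : mu (~` \bigcap_k F k) = 0%E by apply/eqP; rewrite eq_le h measure_ge0.
by rewrite -[\bigcap_k F k]setCK probability_setC ?CI ?sube0 //; exact: measurableC.
Qed.

Lemma mixture_cover (R : realType) (nu : probability (measurableTypeR R) R)
    (n t B : nat) (a : nat -> nat -> R) :
  (1 < t)%N -> (t <= n)%N -> (0 < B)%N ->
  nu `[(0:R), 1]%classic = 1%E ->
  (forall N, nu (\big[setU/set0]_(i < t ^ N) `[a N i, (a N i + (n ^ N)%:R^-1)%R]%classic) = 1%E) ->
  forall m N, mixture nu (reps t B) (copy_mass R t B) (gap R t B) (contraction R n B)
    (cover_set (cover_list (reps t B) (gap R t B) (contraction R n B) n t a m N)) = 1%E.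
Proof.
move=> t1 tn B0 nu01 nuL m N; have t0 := ltnW t1; have n0 : (0 < n)%N := leq_trans t0 tn.
apply: mixture_full; first exact: sum_copy_mass.
move=> l j jJ; set I := cover_list _ _ _ _ _ _ _ _.
have mI : measurable (affine (j%:R * gap R t B l) (contraction R n B l) @^-1` cover_set I).
  have := measurable_affine (j%:R * gap R t B l) (contraction R n B l) measurableT (cover_set_measurable I).
  by rewrite setTI.
have d0 := contraction_gt0 R B l n0; have b0 := gap_gt0 R B l t0.
have [lm|ml] := ltnP l m.
  apply: (probability_eq1_sub _ mI _ (nuL N)).
    by apply: bigsetU_measurable => i _; exact: measurable_itv.
  move=> x /(@bigsetU_ordP R (t ^ N) (fun i => `[a N i, a N i + (n ^ N)%:R^-1]%classic)) [i iN].
  rewrite /= in_itv /= => /andP[x1 x2]; apply/cover_setP.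
  exists ((l, j).2%:R * gap R t B (l, j).1 + contraction R n B (l, j).1 * a N i,
    contraction R n B (l, j).1 / (n ^ N)%:R).
    rewrite inE; apply/orP; right; apply/allpairsP; exists ((l, j), i); split => //=.
      by apply/allpairsPdep; exists l, j; rewrite !mem_iota /= !add0n.
    by rewrite mem_iota.
  rewrite /affine /= -addrA -mulrDr !lerD2l !ler_pM2l //; exact/andP.
apply: (probability_eq1_sub _ mI _ nu01); first exact: measurable_itv.
move=> x /=; rewrite in_itv /= => /andP[x0 x1]; apply/cover_setP.
exists (0, (2 ^ m)%:R^-1); first by rewrite inE eqxx.
rewrite /affine /= add0r; apply/andP; split.
  by rewrite addr_ge0 // mulr_ge0 // ltW.
have db : contraction R n B l <= gap R t B l by exact: contraction_le_gap.
(* J b is exactly 2^(-l), and d <= b keeps the last copy below J b; so the pieces with l >= m lie in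
   [0, 2^(-m)]. *)
apply: (@le_trans _ _ ((reps t B l)%:R * gap R t B l)).
  have : j%:R + 1 <= (reps t B l)%:R :> R by rewrite natr1 ler_nat.
  have : contraction R n B l * x <= contraction R n B l by rewrite ger_pMr.
  nra.
rewrite /reps /gap natrM invfM mulrCA divff ?mulr1; last by rewrite pnatr_eq0 -lt0n expn_gt0 t0.
rewrite lef_pV2 ?posrE ?ltr0n ?expn_gt0 // ler_nat; exact: leq_pexp2l.
Qed.

Lemma mixture_setT (R : realType) (nu : probability (measurableTypeR R) R) (n t B : nat) :
  (0 < t)%N ->
  mixture nu (reps t B) (copy_mass R t B) (gap R t B) (contraction R n B) setT = 1%E.
Proof.
move=> t0; apply: mixture_full; first exact: sum_copy_mass.
by move=> l j _; rewrite preimage_setT; exact: probability_setT.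
Qed.

Lemma mixture_progression (R : realType) (nu : probability (measurableTypeR R) R)
    (n t B l : nat) :
  (0 < t)%N -> (0 < n)%N -> nu `[(0:R), 1]%classic = 1%E ->
  (((1 - mass_ratio R t B) * mass_ratio R t B ^+ l)%:E <=
    mixture nu (reps t B) (copy_mass R t B) (gap R t B) (contraction R n B)
      (progression (reps t B l) (gap R t B l) (contraction R n B l)))%E.
Proof.
move=> t0 n0 nu01; have d0 := contraction_gt0 R B l n0.
have mP : measurable (progression (reps t B l) (gap R t B l) (contraction R n B l)
    : set (measurableTypeR R)).
  by apply: bigsetU_measurable => i _; exact: measurable_itv.
apply: le_trans (mixture_piece_le _ _ _ _ _ l mP).
rewrite -copy_mass_reps // EFinM; apply: lee_wpmul2l; first by rewrite lee_fin.
rewrite (eq_bigr (fun=> 1%:E)) => [|j _]; first by rewrite sumEFin sumr_const card_ord.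
apply: (probability_eq1_sub _ _ _ nu01); first exact: measurable_itv.
  by have := measurable_affine (j%:R * gap R t B l) (contraction R n B l) measurableT mP; rewrite setTI.
move=> x /=; rewrite in_itv /= => /andP[x0 x1].
apply/(@bigsetU_ordP R (reps t B l) (fun j => `[j%:R * gap R t B l, j%:R * gap R t B l + contraction R n B l]%classic)).
exists j => //=; rewrite in_itv /= /affine lerDl lerD2l mulr_ge0 ?(ltW d0) //=.
by rewrite ger_pMr.
Qed.

Lemma progression_sub01 (R : realType) (n t B l : nat) :
  (1 < t)%N -> (t <= n)%N -> (0 < B)%N ->
  progression (reps t B l) (gap R t B l) (contraction R n B l) `<=` `[0, 1].
Proof.
move=> t1 tn B0; have t0 := ltnW t1.
move=> x /(@bigsetU_ordP R (reps t B l) (fun j => `[j%:R * gap R t B l, j%:R * gap R t B l + contraction R n B l]%classic)) [j jJ].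
have b0 := gap_gt0 R B l t0.
have db : contraction R n B l <= gap R t B l by exact: contraction_le_gap.
rewrite /= !in_itv /= => /andP[x1 x2]; apply/andP; split.
  by apply: le_trans x1; rewrite mulr_ge0 // ltW.
apply: (@le_trans _ _ ((reps t B l)%:R * gap R t B l)).
  have : j%:R + 1 <= (reps t B l)%:R :> R by rewrite natr1 ler_nat.
  nra.
rewrite /reps /gap natrM invfM mulrCA divff ?mulr1; last by rewrite pnatr_eq0 -lt0n expn_gt0 t0.
by rewrite invf_le1 ?ltr0n ?expn_gt0 // ler1n expn_gt0.
Qed.

Lemma measure_support_sub (R : realType) (mu : probability (measurableTypeR R) R)
    (E : set R) : closed E -> measurable (E : set (measurableTypeR R)) -> mu E = 1%E ->
  measure_support mu `<=` E.
Proof.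
move=> cE mE muE x sx; apply: contrapT => xE.
have : nbhs x (~` E) by apply: open_nbhs_nbhs; split => //; exact: closed_openC.
move=> /nbhs_ballP[r /= r0 rE].
have := sx r r0; apply/negP; rewrite -leNgt.
have <- : mu (~` E) = 0%E by rewrite probability_setC // muE subee.
by apply: le_measure; rewrite ?inE; [exact: measurable_ball|exact: measurableC|].
Qed.

Lemma ball_frostman (R : realType) (mu : probability (measurableTypeR R) R) (C alpha x r : R) :
  (mu `[(x - r)%R, (x + r)%R]%classic <= (C * r `^ alpha)%:E)%E ->
  (mu (ball x r) <= (C * r `^ alpha)%:E)%E.
Proof.
apply: le_trans; apply: le_measure; rewrite ?inE; [exact: measurable_ball|exact: measurable_itv|].
move=> y; rewrite /ball /= in_itv /= ltr_norml => /andP[y1 y2].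
by apply/andP; split; lra.
Qed.

(* (2 / p - alpha / p - alpha / 2) > 0 is the condition p < 4 / alpha - 2. *)
Lemma ratio_growth (R : realType) (n t B l : nat) (alpha p c : R) :
  (1 < n)%N -> (0 < t)%N -> n%:R `^ alpha = t%:R -> 1 <= p -> 1 <= c ->
  2 <= (2 / p - alpha / p - alpha / 2) * B%:R ->
  2 ^+ l / (4 * c) <= 1 / 2 * Num.sqrt ((1 - mass_ratio R t B) * mass_ratio R t B ^+ l)
    * (n%:R ^+ (2 * (B * l)) / (c * t%:R ^+ (B * l))) `^ p^-1.
Proof.
move=> n1 t0 ntE p1 c1 kB; set kappa := 2 / p - alpha / p - alpha / 2 in kB.
have p0 : 0 < p by lra.
have c0 : 0 < c by lra.
have n0 : 0 < n%:R :> R by rewrite ltr0n (ltnW n1).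
have nn0 : n%:R != 0 :> R by rewrite gt_eqF.
pose M : R := (B * l)%:R.
have TE : t%:R ^+ (B * l) = n%:R `^ (alpha * M) :> R.
  by rewrite -ntE -powR_mulrn ?powR_ge0 // -powRrM.
have p2l : 0 < (2 ^+ l)^-1 :> R by rewrite invr_gt0 exprn_gt0.
have p2l1 : (2 ^+ l)^-1 <= 1 :> R by rewrite invf_le1 ?exprn_gt0 // exprn_ege1 // ler1n.
have q01 := mass_ratio_bounds R B t0.
(* The square root of 2^(-l) is bounded below by 2^(-l) itself, which avoids half powers; the factor
   1/2 takes care of 1 - q >= 1/2. *)
have s1 : (2 ^+ l)^-1 / 2 * n%:R `^ (- (alpha * M / 2)) <=
    Num.sqrt ((1 - mass_ratio R t B) * mass_ratio R t B ^+ l).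
  rewrite -[leLHS]ger0_norm ?mulr_ge0 ?powR_ge0 ?(ltW p2l) // -sqrtr_sqr ler_sqrt; last first.
    by rewrite mulr_ge0 ?exprn_ge0 //; lra.
  have -> : mass_ratio R t B ^+ l = (2 ^+ l)^-1 * n%:R `^ (- (alpha * M)).
    by rewrite /mass_ratio exprVn natrM natrX exprMn -exprM invfM TE powRN.
  rewrite exprMn -[X in _ * X <= _]powR_mulrn ?powR_ge0 // -powRrM.
  have -> : - (alpha * M / 2) * 2 = - (alpha * M) by lra.
  rewrite mulrA; apply: ler_wpM2r; first exact: powR_ge0.
  set z := (2 ^+ l)^-1 in p2l p2l1 *; rewrite expr2; nra.
have s2 : n%:R `^ ((2 - alpha) / p * M) / c <=
    (n%:R ^+ (2 * (B * l)) / (c * t%:R ^+ (B * l))) `^ p^-1.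
  have -> : n%:R ^+ (2 * (B * l)) / (c * t%:R ^+ (B * l)) = n%:R `^ ((2 - alpha) * M) / c.
    rewrite invfM TE mulrA mulrAC; congr (_ / _).
    by rewrite -powRN -(powR_mulrn _ (ltW n0)) -powRD ?nn0 ?implybT // natrM; congr (_ `^ _); rewrite /M; ring.
  rewrite powRM ?powR_ge0 ?invr_ge0 ?(ltW c0) // -powRrM.
  rewrite (_ : (2 - alpha) * M / p = (2 - alpha) / p * M); last by ring.
  apply: ler_wpM2l; first exact: powR_ge0.
  apply: ger1_powR; last by rewrite invf_le1.
  by rewrite invr_gt0 c0 /= invf_le1.
(* B is such that n^(kappa B) >= n^2 >= 4; this 4^l beats the 2^(-l) of [s1] and leaves 2^l. *)
have s3 : 4 ^+ l <= n%:R `^ (kappa * M).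
  rewrite /M natrM mulrA powRrM powR_mulrn ?powR_ge0 //.
  apply: lerXn2r; rewrite ?nnegrE ?powR_ge0 //.
  apply: (@le_trans _ _ (n%:R `^ 2)).
    have n2 : 2 <= n%:R :> R by rewrite ler_nat.
    by rewrite (powR_mulrn 2 (ltW n0)); nra.
  by apply: ler_powR; rewrite ?ler1n ?(ltnW n1).
have E : n%:R `^ (kappa * M) = n%:R `^ (- (alpha * M / 2)) * n%:R `^ ((2 - alpha) / p * M).
  rewrite -powRD ?nn0 ?implybT //; congr (_ `^ _); rewrite /kappa.
  by field; rewrite gt_eqF.
apply: (@le_trans _ _ (1 / 2 * ((2 ^+ l)^-1 / 2 * n%:R `^ (- (alpha * M / 2))) *
    (n%:R `^ ((2 - alpha) / p * M) / c))); last first.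
  apply: ler_pM => //.
  - by rewrite mulr_ge0 ?powR_ge0 // invr_ge0 ltW.
  - by apply: ler_wpM2l.
rewrite (_ : 1 / 2 * _ * _ = (2 ^+ l)^-1 / (4 * c) * n%:R `^ (kappa * M)); last by rewrite E; field; rewrite ?expf_neq0 ?gt_eqF.
apply: (@le_trans _ _ ((2 ^+ l)^-1 / (4 * c) * 4 ^+ l)); last first.
  by apply: ler_wpM2l => //; rewrite mulr_ge0 ?invr_ge0 ?mulr_ge0 // ?ltW.
rewrite (_ : 4 = 2 * 2) ?exprMn; last by lra.
rewrite le_eqVlt; apply/orP; left; apply/eqP; field.
by rewrite ?expf_neq0 ?gt_eqF.
Qed.

(** * Choice of the parameters and assembly *)

Lemma log_ratio_bounds (R : realType) (alpha : R) (t n : nat) :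
  0 < alpha < 1 -> (0 < t)%N -> (0 < n)%N -> n <> 1%N ->
  alpha = ln (t%:R : R) / ln (n%:R : R) ->
  [/\ (1 < t)%N, (t <= n)%N, (1 < n)%N & n%:R `^ alpha = t%:R].
Proof.
move=> /andP[a0 a1] t0 n0 n1 E.
have n1' : (1 < n)%N by lia.
have lnn : 0 < ln (n%:R : R) by rewrite ln_gt0 // ltr1n.
have lnt : ln (t%:R : R) = alpha * ln n%:R by rewrite E divfK // gt_eqF.
have ntE : n%:R `^ alpha = t%:R :> R.
  by rewrite /powR gt_eqF ?ltr0n // -lnt lnK // posrE ltr0n.
have n1R : 1 < n%:R :> R by rewrite ltr1n.
split=> //.
  rewrite -(ltr1n R) -ntE -[ltLHS](powRr0 n%:R); exact: lt1_ltr_powR.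
rewrite -(ler_nat R) -ntE -[leRHS](@powRr1 _ n%:R) ?ler0n //.
by apply: ler_powR; rewrite ltW.
Qed.

(** The quotient b / d = n^(2Bl) / (2^l t^(Bl)) is at least 2^((B-1) l), so B >= 2 and l >= 5 make
    it at least 32. *)
Lemma gap_large (R : realType) (n t B l : nat) :
  (1 < t)%N -> (t <= n)%N -> (1 < B)%N -> (5 <= l)%N ->
  1 <= gap R t B l / (32 * contraction R n B l).
Proof.
move=> t1 tn B1 l5; have t0 := ltnW t1; have n0 : (0 < n)%N := leq_trans t0 tn.
have d0 := contraction_gt0 R B l n0; have b0 := gap_gt0 R B l t0.
rewrite ler_pdivlMr ?mulr_gt0 // mul1r /gap /contraction.
have X0 : 0 < (n ^ (2 * (B * l)))%:R :> R by rewrite ltr0n expn_gt0 n0.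
have T0 : 0 < (2 ^ l * t ^ (B * l))%:R :> R by rewrite ltr0n muln_gt0 !expn_gt0 t0.
rewrite ler_pdivrMr // [leRHS]mulrC ler_pdivlMr // -natrM ler_nat.
rewrite mulnA mul2n -addnn expnD; apply: leq_mul; last first.
  by elim: (B * l)%N => // k IH; rewrite !expnS leq_mul.
apply: (@leq_trans (2 ^ (B * l))); last first.
  by elim: (B * l)%N => // k IH; rewrite !expnS leq_mul // (leq_trans t1).
rewrite (_ : 32 = 2 ^ 5)%N // -expnD leq_exp2l //; nia.
Qed.

Unset Implicit Arguments.

Theorem theorem2 (R : realType) (alpha p : R) (t0 n0 : nat)
  (halpha : 0 < alpha < 1)
  (ht0 : (0 < t0)%N) (hn0 : (0 < n0)%N) (hn01 : n0 <> 1%N)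
  (hlog : alpha = ln (t0%:R : R) / ln (n0%:R : R))
  (hp : 1 <= p < 4 / alpha - 2) :
  exists (mu : probability (measurableTypeR R) R) (E : set R)
         (f : nat -> R -> R),
    [/\ mu (`[0, 1]%classic : set R) = 1%E,
        E `<=` `[0, 1],
        measure_support mu `<=` E &
        hausdorff_dim E = alpha%:E] /\
    (forall l : nat, exists A : set R,
      [/\ A `<=` `[0, 1], finite_union_of_intervals A & f l = \1_A]) /\
    (exists C1 : R, forall x r : R, 0 < r ->
      (mu (ball x r) <= (C1 * r `^ alpha)%:E)%E) /\
    (forall beta : R, 0 < beta < alpha ->
      exists C2 : R, forall xi : R,
        normc (fourier mu xi) <= C2 * (1 + `|xi|) `^ (- (beta / 2))) /\
    (forall l : nat, 'N[mu]_(2%:E)[EFin \o f l]%E <> 0%E) /\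
    (fun l : nat =>
       ('N[@lebesgue_measure R]_(p%:E)
          [(fun xi : R => (normc (fourier_density mu (f l) xi))%:E)]
        / 'N[mu]_(2%:E)[EFin \o f l])%E) @ \oo --> +oo%E.
Proof.
have [t1 tn n1 ntE] := log_ratio_bounds halpha ht0 hn0 hn01 hlog.
have [a0 a1] := andP halpha; have [p1 p2] := andP hp.
have p0 : 0 < p by lra.
have a01 : 0 < alpha <= 1 by rewrite a0 ltW.
have [nu [a [nu01 nuL nuF nuD]]] := salem_measure n1 ht0 tn a01 ntE.
pose kappa := 2 / p - alpha / p - alpha / 2.
have kappa0 : 0 < kappa.
  have h : p * alpha < 4 - 2 * alpha.
    by move: p2; rewrite -(ltr_pM2r a0) mulrBl divfK ?gt_eqF.
  have -> : kappa = (4 - 2 * alpha - p * alpha) / (2 * p) by rewrite /kappa; field; rewrite gt_eqF.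
  by rewrite divr_gt0 ?mulr_gt0 //; lra.
(* One successor makes B exceed 2 / kappa, the other gives the B >= 2 required by [gap_large]. *)
pose B := (Num.truncn (2 / kappa)).+2.
have kB : 2 <= kappa * B%:R.
  rewrite mulrC -ler_pdivrMr //; apply/ltW/(lt_trans (truncnS_gt _)).
  by rewrite ltr_nat.
pose mix := mixture nu (reps t0 B) (copy_mass R t0 B) (gap R t0 B) (contraction R n0 B).
have mix1 : mix setT = 1%E by exact: mixture_setT.
pose mu : probability (measurableTypeR R) R := normalized mix1.
pose E := carrier (reps t0 B) (gap R t0 B) (contraction R n0 B) n0 t0 a.
pose S l := progression (reps t0 B l) (gap R t0 B l) (contraction R n0 B l).
have mE : measurable (E : set (measurableTypeR R)) by exact: carrier_measurable.
have mS l : measurable (S l : set (measurableTypeR R)).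
  by apply: bigsetU_measurable => i _; exact: measurable_itv.
have muE : mu E = 1%E.
  rewrite /E /carrier; apply: probability_bigcap => m.
    by apply: bigcap_measurable => // N _; exact: cover_set_measurable.
  apply: probability_bigcap => N; first exact: cover_set_measurable.
  exact: mixture_cover.
have E01 : E `<=` `[0, 1]%classic by exact: carrier_sub01.
pose C1 := 4 + 4 * (4 * t0%:R) : R.
have C10 : 1 <= C1 by rewrite /C1; have := ler0n R t0; lra.
have frost x r : 0 < r -> (mu `[(x - r)%R, (x + r)%R]%classic <= (C1 * r `^ alpha)%:E)%E.
  move=> r0; have [r1|r1] := leP r 1.
    apply: (mixture_frostman t1 tn _ a01 ntE _ nu01 nuF) => //.
    by rewrite r0.
  apply: (@le_trans _ _ 1%E); first exact: probability_le1.
  rewrite lee_fin -[leLHS]mulr1; apply: ler_pM => //.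
  by rewrite -[leLHS](powRr0 r) ler_powR ?(ltW r1) // ltW.
have muS l : (((1 - mass_ratio R t0 B) * mass_ratio R t0 B ^+ l)%:E <= mu (S l))%E.
  exact: mixture_progression.
have q0 : 0 < mass_ratio R t0 B by rewrite invr_gt0 ltr0n muln_gt0 expn_gt0 ht0.
have q1 := mass_ratio_bounds R B ht0.
have m0 l : 0 < (1 - mass_ratio R t0 B) * mass_ratio R t0 B ^+ l.
  by rewrite mulr_gt0 ?exprn_gt0 //; lra.
exists mu, E, (fun l => \1_(S l)); split; [split|split; [|split; [|split; [|split]]]].
- exact: (probability_eq1_sub mE _ E01 muE).
- exact: E01.
- by apply: measure_support_sub => //; exact: carrier_closed.
- apply: hausdorff_dim_eq; first exact: ltW.
    move=> s sa; apply: (carrier_hausdorff_eq0 _ _ _ n1 ntE (ltW a0) _ sa) => l.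
    rewrite ltW ?contraction_gt0 //= /contraction invf_le1 ?ltr0n ?expn_gt0 ?hn0 //.
    by rewrite ler1n expn_gt0 hn0.
  move=> s s0 hs; exact: (mass_distribution mE muE (le_trans ler01 C10) a0 frost s0 hs).
- move=> l; exists (S l); split => //.
    exact: progression_sub01.
  exists [seq `[j%:R * gap R t0 B l, j%:R * gap R t0 B l + contraction R n0 B l]
     | j <- iota 0 (reps t0 B l)].
  rewrite big_map /S /progression.
  by rewrite -(big_mkord xpredT (fun j => `[j%:R * gap R t0 B l, j%:R * gap R t0 B l + contraction R n0 B l]%classic)) /index_iota subn0.
- by exists C1 => x r r0; apply: ball_frostman; exact: frost.
- move=> beta b0a; have [b0 ba] := andP b0a.
  have [D D0 hD] := nuD beta b0a.
  have nbt : n0%:R `^ beta <= t0%:R by rewrite -ntE ler_powR ?ler1n // ltW.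
  exists (2 * (2 * D) + 4); apply: fourier_decay.
  - by apply/andP; split; lra.
  - by rewrite mulr_ge0.
  - move=> eta theta eta0.
    rewrite (eq_measure_integral mix) //.
    exact: (mixture_fourier B ht0 hn0 (ltW b0) D0 nbt hD theta eta0).
- move=> l; rewrite Lnorm2_indic // => /eqP; rewrite eqe sqrtr_eq0 leNgt => /negP; apply.
  rewrite -lte_fin fineK ?fin_num_measure //; apply: lt_le_trans (muS l).
  by rewrite lte_fin.
apply/cvgeyPge => A.
(* The dual set has measure K s / b with K >= b / (64 d) and s = 1 / (32 J), hence at least 1 / (64
   * 32 * d J). *)
pose cst : R := 64 * 32.
have c1 : 1 <= cst by rewrite /cst; lra.
near=> l.
have d0 := contraction_gt0 R B l hn0; have b0 := gap_gt0 R B l ht0.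
set d := contraction R n0 B l in d0; set b := gap R t0 B l in b0.
set J := reps t0 B l.
have dE : d = (n0%:R ^+ (2 * (B * l)))^-1 by rewrite /d /contraction natrX.
have JE : J%:R = t0%:R ^+ (B * l) :> R by rewrite /J /reps natrX.
have bE : b = (2 ^+ l * t0%:R ^+ (B * l))^-1 by rewrite /b /gap natrM !natrX.
have J0 : 0 < J%:R :> R by rewrite ltr0n expn_gt0 ht0.
pose s : R := (32 * J%:R)^-1.
have J1 : 1 <= J%:R :> R by rewrite ler1n expn_gt0 ht0.
have s0 : 0 < s by rewrite invr_gt0 mulr_gt0.
have s1 : s < 1 by rewrite invf_lt1 ?mulr_gt0 //; lra.
have Js : J%:R * s = 1 / 32 by rewrite /s; field; rewrite gt_eqF.
(* The largest K with K d <= b / 32, so the frequencies reach up to about 1 / (32 d). As b / (32 d)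
   >= 1, truncation loses at most a factor 2, which turns 32 into 64. *)
pose K := Num.truncn (b / (32 * d)).
have bd : 1 <= b / (32 * d).
  have l5 : (5 <= l)%N by near: l; exists 5%N.
  exact: (gap_large R t1 tn _ l5).
have K1 : 1 <= K%:R :> R by rewrite ler1n truncn_gt0.
have [K2 K3] : K%:R <= b / (32 * d) /\ b / (32 * d) < K%:R + 1.
  have := @truncn_itv R (b / (32 * d)); rewrite (le_trans ler01 bd) => /(_ isT) /andP[-> h].
  by rewrite natr1.
pose g := n0%:R ^+ (2 * (B * l)) / (cst * t0%:R ^+ (B * l)) : R.
have gE : g = b / (64 * d) * (s / b).
  rewrite /g /cst /s dE JE; set X := _ ^+ _; set T := _ ^+ _.
  have X0 : X != 0 by rewrite expf_neq0 // pnatr_eq0 -lt0n.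
  have T0 : T != 0 by rewrite expf_neq0 // pnatr_eq0 -lt0n.
  by field; rewrite X0 T0 gt_eqF.
have g0 : 0 <= g by rewrite gE mulr_ge0 // ?divr_ge0 ?mulr_ge0 // ltW.
pose G := dual_set K b s.
have mG : measurable (G : set (measurableTypeR R)).
  by apply: bigsetU_measurable => i _; exact: measurable_itv.
have gG : (g%:E <= @lebesgue_measure R G)%E.
  rewrite dual_set_measure //; last by rewrite (ltW s0).
  rewrite lee_fin gE; apply: ler_wpM2r; first by rewrite divr_ge0 ?ltW.
  have -> : b / (64 * d) = b / (32 * d) / 2 by field; rewrite gt_eqF.
  lra.
apply: le_trans (norm_ratio_ge (mS l) mG p0 (m0 l) g0 (muS l) gG _); last first.
  move=> xi x xiG xS; apply: (cos_progression_ge b0 (ltW d0) _ _ _ xS xiG).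
  - by rewrite (ltW s0) ltW.
  - by rewrite Js.
  - by move: K2; rewrite ler_pdivlMr ?mulr_gt0 //; lra.
rewrite lee_fin; apply: le_trans (ratio_growth l n1 ht0 ntE p1 c1 kB).
rewrite ler_pdivlMr ?mulr_gt0 //.
have lA : (Num.truncn (A * (4 * cst)) < l)%N.
  by near: l; exists (Num.truncn (A * (4 * cst))).+1.
apply/ltW/(lt_le_trans (truncnS_gt _)); rewrite -natrX ler_nat.
exact: leq_trans lA (ltnW (ltn_expl _ _)).
Unshelve. all: by end_near.
Qed.
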